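(* Let $F_\pm(x)=x^2f_\pm(x)$ and $G_\pm$ be $C^\infty$-smooth near $x=0$ with $f_\pm(0)>0$, $G_\pm(0)=0$, $G_\pm'(0)<0$, let $\psi_\pm$ be the inverse (near $0$) of $x\mapsto x\sqrt{f_\pm(x)}$, and consider the piecewise smooth slow-fast system $$\begin{cases}\dot x=y-x^2,\\ \dot y=\epsilon\, G_-(\psi_-(x))\psi_-'(x),\end{cases}\ x\le0,\qquad \begin{cases}\dot x=y-x^2,\\ \dot y=\epsilon\, G_+(\psi_+(x))\psi_+'(x),\end{cases}\ x\ge0,$$ with $0<\epsilon\ll1$ and slow relation function $H$. Define $$\bar G(x)=G_-(\psi_-(x))\psi_-'(x)+G_+(\psi_+(-x))\psi_+'(-x),$$ let $m_0(\bar G)\in\{1,2,\dots\}\cup\{\infty\}$ be the multiplicity of the zero $x=0$ of $\bar G$, and, if $m_0(\bar G)<\infty$, let $g_{m_0(\bar G)}\ne0$ be the $m_0(\bar G)$-th Taylor coefficient of $\bar G$ about $x=0$. Suppose that $y^*>0$ is small and $I=I_+-I_-$ (difference of the slow divergence integrals, see context) is nonzero on $]0,y^*[$. Given $y_0\in\,]0,y^*[$, the following hold. 1. Suppose $1\le m_0(\bar G)<\infty$. If $(-1)^{m_0(\bar G)+1}g_{m_0(\bar G)}>0$ (resp. $<0$), then the orbit $U=\{y_l\mid l\in\mathbb N\}$ of $y_0$ by $H$ (resp. $H^{-1}$) tends monotonically to $0$, and the following bijective correspondence holds: $$m_0(\bar G)=\frac{1+\dim_BU}{1-\dim_BU}.$$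 Moreover, if $1<m_0(\bar G)<\infty$, then $U$ is Minkowski nondegenerate. 2. If $m_0(\bar G)=\infty$, then $\dim_BU=1$, where $U$ is the orbit of $y_0$ by $H$ if $I>0$ on $]0,y^*[$ and by $H^{-1}$ if $I<0$ on $]0,y^*[$. These results do not depend on the choice of the initial point $y_0\in\,]0,y^*[$.
   Context: Slow divergence integrals of the system: for small $y>0$, $$I_\pm(y)=-4\int_{\pm\sqrt y}^{0}\frac{x^2}{G_\pm(\psi_\pm(x))\psi_\pm'(x)}\,dx<0,\qquad I(y)=I_+(y)-I_-(y).$$ $I_\pm$ are strictly decreasing and tend to $0$ as $y\to0^+$. The slow relation function $H$ is defined for small $y>0$ by $I_-(H(y))=I_+(y)$. The orbit of $y_0$ by $H$ is given by $I_-(y_{l+1})=I_+(y_l)$, $l\ge0$, and the orbit by $H^{-1}$ is given by $I_-(y_l)=I_+(y_{l+1})$, $l\ge0$. The number $y^*$ is taken small enough that everything is defined. Minkowski dimension: for bounded $U\subset\mathbb R$ let $|U_\delta|$ be the Lebesgue measure of the closed $\delta$-neighborhood $U_\delta=\{x:\mathrm{dist}(x,U)\le\delta\}$. For $s\ge0$ put $\mathcal M_*^s(U)=\liminf_{\delta\to0}|U_\delta|/\delta^{1-s}$ and $\mathcal M^{*s}(U)=\limsup_{\delta\to0}|U_\delta|/\delta^{1-s}$; $\underline\dim_BU=\inf\{s\ge0:\mathcal M_*^s(U)=0\}$, $\overline\dim_BU=\inf\{s\ge0:\mathcal M^{*s}(U)=0\}$. If they coincide, the common value is $\dim_BU$.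 $U$ is Minkowski nondegenerate if there is $d$ with $0<\mathcal M_*^d(U)\le\mathcal M^{*d}(U)<\infty$ (then $d=\dim_BU$). *)

(* Defs.v *)
From HB Require Import structures.
From mathcomp Require Import all_boot all_order all_algebra.
From mathcomp Require Import all_classical all_reals all_analysis.
Set Implicit Arguments.
Unset Strict Implicit.
Unset Printing Implicit Defensive.
Import Order.TTheory GRing.Theory Num.Theory.
Import numFieldNormedType.Exports.
Local Open Scope classical_set_scope.
Local Open Scope ring_scope.

(* One neighbourhood of 0 serves for all orders of differentiation. *)
Definition smooth_near0 (R : realType) (f : R -> R) : Prop :=
  \forall x \near (0 : R), forall n : nat, derivable (derive1n n f) x 1.

Definition local_inverse0 (R : realType) (phi psi : R -> R) : Prop :=
  (\forall x \near (0 : R), psi (phi x) = x) /\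
  (\forall x \near (0 : R), phi (psi x) = x).

Definition taylor_coef0 (R : realType) (f : R -> R) (k : nat) : R :=
  derive1n k f 0 / (k`!)%:R.

Definition zero_multiplicity (R : realType) (f : R -> R) (m : nat) : Prop :=
  (forall k, (k < m)%N -> taylor_coef0 f k = 0) /\ taylor_coef0 f m != 0.

Definition zero_multiplicity_infinite (R : realType) (f : R -> R) : Prop :=
  forall k, taylor_coef0 f k = 0.

Definition oriented_integral (R : realType) (a b : R) (h : R -> R) : R :=
  if a <= b then Rintegral lebesgue_measure `[a, b] h
  else - Rintegral lebesgue_measure `[b, a] h.

(* The right-hand side of [y' = eps * G (psi x) * psi' x], without [eps]. *)
Definition slow_drift (R : realType) (G psi : R -> R) (x : R) : R :=
  G (psi x) * derive1 psi x.

(* The integrand is [0 / 0] at [x = 0], hence [0] there; this single point does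
   not affect the integral. *)
Definition slow_div_integral (R : realType) (G psi : R -> R) (a : R) : R :=
  - 4 * oriented_integral a 0 (fun x => x ^+ 2 / slow_drift G psi x).

Definition Iplus (R : realType) (G psi : R -> R) (y : R) : R :=
  slow_div_integral G psi (Num.sqrt y).

Definition Iminus (R : realType) (G psi : R -> R) (y : R) : R :=
  slow_div_integral G psi (- Num.sqrt y).

(* [slow_relation ystar Im Ip] is the graph of the slow relation function [H]
   with values in ]0, ystar[: [z = H y] iff [Im z = Ip y].  Exchanging [Im] and
   [Ip] gives the graph of [H^-1]. *)
Definition slow_relation (R : realType) (ystar : R) (Im Ip : R -> R)
    (y z : R) : Prop :=
  0 < z < ystar /\ Im z = Ip y.

Definition is_orbit (R : realType) (rel : R -> R -> Prop) (y0 : R)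
    (u : nat -> R) : Prop :=
  u 0%N = y0 /\ forall l, rel (u l) (u l.+1).

Definition closed_nbhd (R : realType) (U : set R) (delta : R) : set R :=
  [set x | (edist_inf U x <= delta%:E)%E].

Definition minkowski_ratio (R : realType) (s : R) (U : set R) (delta : R)
    : \bar R :=
  (lebesgue_measure (closed_nbhd U delta) * ((delta `^ (1 - s))^-1)%:E)%E.

Definition lower_content (R : realType) (s : R) (U : set R) : \bar R :=
  limf_einf (minkowski_ratio s U) 0^'+.

Definition upper_content (R : realType) (s : R) (U : set R) : \bar R :=
  limf_esup (minkowski_ratio s U) 0^'+.

(* For bounded [U] the sets below contain every [s > 1], so that [inf] is a
   genuine infimum. *)
Definition lower_minkowski_dim (R : realType) (U : set R) : R :=
  inf [set s | 0 <= s /\ lower_content s U = 0%E].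

Definition upper_minkowski_dim (R : realType) (U : set R) : R :=
  inf [set s | 0 <= s /\ upper_content s U = 0%E].

Definition has_minkowski_dim (R : realType) (U : set R) (d : R) : Prop :=
  lower_minkowski_dim U = d /\ upper_minkowski_dim U = d.

Definition minkowski_nondegenerate (R : realType) (U : set R) : Prop :=
  exists d : R, [/\ 0 <= d, (0 < lower_content d U)%E,
    (lower_content d U <= upper_content d U)%E &
    (upper_content d U < +oo)%E].

(* Main.v *)
Require Import Defs.
From HB Require Import structures.
From mathcomp Require Import all_boot all_order all_algebra.
From mathcomp Require Import all_classical all_reals all_analysis.
From mathcomp Require Import measurable_realfun ring lra.
Set Implicit Arguments.
Unset Strict Implicit.
Unset Printing Implicit Defensive.
Import Order.TTheory GRing.Theory Num.Theory.
Import numFieldNormedType.Exports.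
Local Open Scope classical_set_scope.
Local Open Scope ring_scope.

(** Reflecting the left half plane puts both slow divergence integrals on the
    same interval: I_+(y) and I_-(y) are four times the integrals over
    [0, sqrt y] of s^2 / D1(s) and of s^2 / D2(s), where D1(s) is the right
    drift at s and D2(s) is minus the left drift at -s.  Both D1 and D2 vanish
    at 0 with negative slope, so I_+ and I_- are decreasing and bi-Lipschitz
    near 0 ([slow_integral_bilipschitz]).  Moreover D2(s) - D1(s) = - Gbar(-s),
    hence I = I_+ - I_- is four times the integral of - Gbar(-s) against the
    weight s^2 / (D1(s) D2(s)), which lies between two positive constants.  If
    Gbar has multiplicity m and c denotes (-1)^(m+1) times its m-th Taylor
    coefficient, then - Gbar(-s) is equivalent to c s^m and I(y) is comparable
    to c y^((m+1)/2); if Gbar is flat, then I(y) = O(y^N) for every N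
    ([slow_integral_diff_le], [slow_integral_diff_ge]).

    The relation I_-(y_{l+1}) = I_+(y_l) says that I_-(y_{l+1}) - I_-(y_l) is
    I(y_l), so the bi-Lipschitz bounds make the gap y_l - y_{l+1} comparable to
    I(y_l).  The intermediate value theorem gives the orbit, which decreases to
    0 because a positive limit would be a zero of I ([orbit_exists]).  When I is
    negative, I_+ and I_- exchange their roles, and H is replaced by its
    inverse.

    The rest is a statement on decreasing null sequences u whose gaps are
    comparable to u^al, al = (m+1)/2.  If al > 1, the volume of the closed
    d-neighbourhood is comparable to d^(1/al) ([powerlaw_gap_measure_le],
    [powerlaw_gap_measure_ge]), so the Minkowski contents of exponent 1 - 1/al
    are positive and finite, and the dimension is 1 - 1/al = (m-1)/(m+1), that
    is m = (1+dim)/(1-dim).  If m = 1, the gaps exceed a multiple of u^t for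
    every t > 1 and the dimension is 0; if Gbar is flat, they are below a
    multiple of every power and the dimension is 1.

    Taylor's formula for Gbar requires the drifts to be smooth at 0: f is
    obtained from x^2 f(x) by dividing twice by x ([Cn_at0_divX]), psi is smooth
    by the inverse function theorem ([Cn_at0_inverse]), and smoothness passes
    to products and compositions. *)

(** * Germs of class C^n at 0 *)

Section germs.
Context {R : realType}.
Implicit Types (f df g h p q psi : R -> R) (n m : nat).

(** The derivatives of order at most n exist near 0 and the n-th one is
    continuous at 0; for n = 0 this is continuity at 0.  The neighbourhood may shrink with n, which makes the class
    stable under composition and inversion by plain induction on n. *)
Fixpoint Cn_at0 n f : Prop :=
  if n is n'.+1 then
    (\forall x \near (0 : R), derivable f x 1) /\ Cn_at0 n' (derive1 f)
  else {for 0, continuous f}.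

Lemma smooth_Cn_at0 f n : smooth_near0 f -> Cn_at0 n f.
Proof.
elim: n f => [|n IH] f sf /=.
  apply: differentiable_continuous; apply/derivable1_diffP.
  exact: (nbhs_singleton sf 0%N).
split.
  apply: filterS sf => x; exact: (fun H => H 0%N).
apply: IH; apply: filterS sf => x H k; rewrite -derive1Sn; exact: H.
Qed.

Lemma Cn_at0_continuous f n : Cn_at0 n f -> f x @[x --> (0 : R)] --> f 0.
Proof.
case: n => [//|n] [df _]; apply: differentiable_continuous.
by apply/derivable1_diffP; exact: (nbhs_singleton df).
Qed.

Lemma near_eq_Cn_at0 f g n : (\forall x \near (0 : R), f x = g x) ->
  Cn_at0 n f -> Cn_at0 n g.
Proof.
elim: n f g => [|n IH] f g fg.
  move=> cf; change (g x @[x --> 0] --> g 0); rewrite -(nbhs_singleton fg).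
  apply: cvg_trans cf; exact: near_eq_cvg.
have fg1 : \forall x \near (0 : R), {near x, f =1 g}.
  exact: (nbhs_interior fg).
move=> [df cf]; split.
  by apply: filterS2 df fg1 => x dfx fgx; exact: (near_eq_derivable fgx dfx).
apply: IH cf; apply: filterS fg1 => x fgx.
by rewrite !derive1E; exact: near_eq_derive.
Qed.

Lemma Cn_at0S f df n : (\forall x \near (0 : R), is_derive (x : R) (1 : R) f (df x)) ->
  Cn_at0 n df -> Cn_at0 n.+1 f.
Proof.
move=> fdf dfn; split; first by apply: filterS fdf => x [].
apply: near_eq_Cn_at0 dfn; apply: filterS fdf => x dfx.
by rewrite derive1E; apply/esym; exact: derive_val.
Qed.

Lemma Cn_at0S_derive f n : Cn_at0 n.+1 f ->
  \forall x \near (0 : R), is_derive (x : R) (1 : R) f (derive1 f x).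
Proof.
move=> [df _]; apply: filterS df => x dfx.
by rewrite derive1E; apply: derivableP.
Qed.

Lemma Cn_at0W f n : Cn_at0 n.+1 f -> Cn_at0 n f.
Proof.
elim: n f => [|n IH] f; first exact: Cn_at0_continuous.
by move=> [? /IH].
Qed.

Lemma Cn_at0_cst (c : R) n : Cn_at0 n (cst c).
Proof.
elim: n c => [|n IH] c; first exact: cst_continuous.
apply: (@Cn_at0S _ (cst 0)) (IH 0).
by apply: (@filterE _ (nbhs (0 : R))) => x; exact: is_derive_cst.
Qed.

Lemma Cn_at0_id n : Cn_at0 n (id : R -> R).
Proof.
case: n => [|n]; first exact: (@cvg_id _ (nbhs (0 : R))).
apply: (@Cn_at0S _ (cst 1)) (Cn_at0_cst 1 n).
by apply: (@filterE _ (nbhs (0 : R))) => x; exact: is_derive_id.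
Qed.

Lemma Cn_at0D f g n : Cn_at0 n f -> Cn_at0 n g -> Cn_at0 n (f \+ g).
Proof.
elim: n f g => [|n IH] f g; first exact: continuousD.
move=> nf ng; apply: (@Cn_at0S _ (derive1 f \+ derive1 g)).
  have df := Cn_at0S_derive nf; have dg := Cn_at0S_derive ng.
  near=> x; apply: is_deriveD; [exact: (near df x)|exact: (near dg x)].
by apply: IH; [exact: nf.2|exact: ng.2].
Unshelve. all: by end_near. Qed.

Lemma Cn_at0M f g n : Cn_at0 n f -> Cn_at0 n g -> Cn_at0 n (f \* g).
Proof.
elim: n f g => [|n IH] f g; first exact: continuousM.
move=> nf ng; apply: (@Cn_at0S _ ((f \* derive1 g) \+ (g \* derive1 f))).
  have df := Cn_at0S_derive nf; have dg := Cn_at0S_derive ng.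
  near=> x; apply: is_deriveM; [exact: (near df x)|exact: (near dg x)].
by apply: Cn_at0D; apply: IH; [exact: Cn_at0W|exact: ng.2|exact: Cn_at0W|exact: nf.2].
Unshelve. all: by end_near. Qed.

Lemma Cn_at0_comp f g n : g 0 = 0 -> Cn_at0 n f -> Cn_at0 n g -> Cn_at0 n (f \o g).
Proof.
move=> g0; elim: n f => [|n IH] f nf ng.
  by apply: continuous_comp => //; rewrite g0.
apply: (@Cn_at0S _ ((derive1 f \o g) \* derive1 g)).
  have cg : g @ nbhs 0 --> (0 : R).
    by rewrite -[X in _ --> X]g0; exact: Cn_at0_continuous ng.
  have df : \forall x \near (0 : R), is_derive (g x) (1 : R) f (derive1 f (g x)).
    exact: cg _ (Cn_at0S_derive nf).
  have dg := Cn_at0S_derive ng.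
  near=> x; apply: is_derive1_comp; [exact: (near df x)|exact: (near dg x)].
apply: Cn_at0M; last exact: ng.2.
by apply: IH; [exact: nf.2|exact: Cn_at0W].
Unshelve. all: by end_near. Qed.

(** The derivative of 1/f is - (1/f)^2 f', which involves 1/f only at the
    previous order; the same bootstrap gives square roots and inverse
    functions. *)
Lemma Cn_at0V f n : f 0 != 0 -> Cn_at0 n f -> Cn_at0 n (fun x => (f x)^-1).
Proof.
move=> f0; elim: n => [|n IH] nf; first exact: continuousV.
set g := fun x => _.
have ng : Cn_at0 n g by apply: IH; exact: Cn_at0W.
apply: (@Cn_at0S _ (((cst (-1)) \* (g \* g)) \* derive1 f)).
  have cf := Cn_at0_continuous nf.
  have fn0 : \forall x \near (0 : R), f x != 0.
    exact: cvgr_neq0 cf f0.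
  have df := Cn_at0S_derive nf; near=> x.
  apply: is_derive_eq; first by apply: is_deriveV; [near: x|exact: (near df x)].
  by rewrite /g /= /GRing.scale /= expr2 invfM; ring.
apply: Cn_at0M; last exact: nf.2.
apply: Cn_at0M; last exact: Cn_at0M.
exact: Cn_at0_cst.
Unshelve. all: by end_near. Qed.

Lemma Cn_at0_sqrt f n : 0 < f 0 -> Cn_at0 n f ->
  Cn_at0 n (fun x => Num.sqrt (f x)).
Proof.
move=> f0; elim: n => [|n IH] nf.
  by apply: continuous_comp => //; exact: sqrt_continuous.
set g := fun x => _.
have ng : Cn_at0 n g by apply: IH; exact: Cn_at0W.
apply: (@Cn_at0S _ (((cst 2^-1) \* (fun x => (g x)^-1)) \* derive1 f)).
  have cf := Cn_at0_continuous nf.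
  have fn0 : \forall x \near (0 : R), 0 < f x.
    exact: cvgr_gt cf _ f0.
  have df := Cn_at0S_derive nf; near=> x.
  apply: is_derive_eq.
    apply: (@is_derive1_comp _ Num.sqrt); last exact: (near df x).
    by apply: is_derive1_sqrt; near: x.
  by rewrite /g /= invfM.
apply: Cn_at0M; last exact: nf.2.
apply: Cn_at0M; first exact: Cn_at0_cst.
by apply: Cn_at0V => //; rewrite /g gt_eqF// sqrtr_gt0.
Unshelve. all: by end_near. Qed.

(** * Taylor expansion and division by powers of x *)

Lemma lhopital_dnbhs f df g dg (l : R) :
  (\forall x \near (0 : R)^', is_derive (x : R) (1 : R) f (df x)) ->
  (\forall x \near (0 : R)^', is_derive (x : R) (1 : R) g (dg x)) ->
  (\forall x \near (0 : R)^', dg x != 0) ->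
  f x @[x --> (0 : R)] --> (0 : R) -> g x @[x --> (0 : R)] --> (0 : R) ->
  df x / dg x @[x --> (0 : R)^'] --> l -> f x / g x @[x --> (0 : R)^'] --> l.
Proof.
move=> fdf gdg dg0 f0 g0 l0.
(* The quotient df / dg is 0 / 0 at 0; giving it there the value l turns the
   punctured limit into the full one that the two-sided rule asks for. *)
pose df' x := if x == 0 then l else df x.
pose dg' x := if x == 0 then 1 else dg x.
have [e /= e0 He] : \forall x \near (0 : R)^', [/\ is_derive (x : R) (1 : R) f (df x),
   is_derive (x : R) (1 : R) g (dg x) & dg x != 0].
  by near=> x; split; near: x.
have inD x : x \in `]- e, e[ `\ 0 -> x != 0 /\ [/\ is_derive (x : R) (1 : R) f (df x),
   is_derive (x : R) (1 : R) g (dg x) & dg x != 0].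
  rewrite inE/= => -[xe /eqP x0]; split => //.
  apply: He => //=; rewrite sub0r normrN ltr_norml; by move: xe; rewrite in_itv.
apply: (@lhopital R f df' g dg' (- e) e 0 l) => //.
- by rewrite in_itv/= oppr_lt0 e0.
- by move=> x /inD[x0 [? ? ?]]; rewrite /df' (negbTE x0).
- by move=> x /inD[x0 [? ? ?]]; rewrite /dg' (negbTE x0).
- by move=> x /inD[x0 [? ? ?]]; rewrite /dg' (negbTE x0).
suff : {for 0, continuous (fun x => df' x / dg' x)}.
  by rewrite /prop_for /continuous_at {2}/df' {2}/dg' eqxx divr1.
apply/continuous_withinNx.
rewrite {2}/df' {2}/dg' eqxx divr1.
apply: cvg_trans l0; apply: near_eq_cvg; near=> x.
rewrite /df' /dg'; have /negbTE-> // : x != 0.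
by near: x; exact: nbhs_dnbhs_neq.
Unshelve. all: by end_near. Qed.

Lemma is_derive_exprn (x : R) n :
  is_derive x (1 : R) (fun y : R => y ^+ n.+1) (n.+1%:R * x ^+ n).
Proof.
have := is_deriveX n.+1 (is_derive_id x (1 : R)).
by rewrite exprfctE /GRing.scale /= mulr1.
Qed.

(** Peano's form of Taylor's formula, by iterating L'Hopital's rule. *)
Lemma Cn_at0_peano f m : Cn_at0 m f ->
  (forall k, (k < m)%N -> derive1n k f 0 = 0) ->
  f x / x ^+ m @[x --> (0 : R)^'] --> derive1n m f 0 / (m`!)%:R.
Proof.
elim: m f => [|m IH] f.
  move=> /continuous_withinNx cf _; rewrite derive1n0 divr1.
  apply: cvg_trans cf.
  apply: near_eq_cvg; near=> x; by rewrite expr0 divr1.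
move=> nf f0.
apply: (@lhopital_dnbhs _ (derive1 f) _ (fun x => m.+1%:R * x ^+ m)).
- exact: cvg_within (Cn_at0S_derive nf).
- by near=> x; exact: is_derive_exprn.
- near=> x; rewrite mulf_neq0 ?pnatr_eq0// expf_neq0//.
  by near: x; exact: nbhs_dnbhs_neq.
- by rewrite -[X in _ --> X](f0 0%N)//; exact: Cn_at0_continuous nf.
- rewrite -[X in _ --> X](expr0n R m.+1); exact: exprn_continuous.
rewrite derive1Sn factS natrM invfM mulrCA mulrC.
have : derive1 f x / x ^+ m @[x --> (0:R)^'] --> derive1n m (derive1 f) 0 / (m`!)%:R.
  apply: IH; first exact: nf.2.
  by move=> k km; rewrite -derive1Sn; apply: f0.
move=> H; apply: cvg_trans (cvgM H (cvg_cst (m.+1%:R^-1 : R))).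
apply: near_eq_cvg; near=> x.
by rewrite /= invfM; ring.
Unshelve. all: by end_near. Qed.

Lemma Cn_at0_peano_le f m (e : R) : Cn_at0 m f -> 0 < e ->
  (forall k, (k < m)%N -> derive1n k f 0 = 0) ->
  exists2 r, 0 < r & forall x, 0 < `|x| < r ->
    `|f x - taylor_coef0 f m * x ^+ m| <= e * `|x| ^+ m.
Proof.
move=> nf e0 f0.
have /cvgrPdist_le/(_ e e0) [r /= r0 H] := Cn_at0_peano nf f0.
exists r => // x /andP[x0 xr].
have xn0 : x != 0 by rewrite -normr_gt0.
have := H x; rewrite /= sub0r normrN => /(_ xr xn0).
rewrite distrC -normrX => h.
have -> : f x = f x / x ^+ m * x ^+ m by rewrite divfK// expf_neq0.
by rewrite -mulrBl normrM ler_wpM2r.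
Qed.

(** Regularity of the continuous solution of Euler's equation
    x q' + (a+1) q = h.  Its derivative p = q' solves the same equation with a+1
    and h' in place of a and h, whence the induction on n.  What has to be
    checked is that p extends continuously to 0: since
    (x^(a+2) p)' = x^(a+1) h', L'Hopital's rule gives p(0) = h'(0) / (a+2), and
    a second use of it shows that q is differentiable at 0 with derivative
    p(0). *)
Lemma Cn_at0_euler_div a h q dq n : {for 0, continuous q} -> Cn_at0 n h ->
  (\forall x \near (0 : R)^', is_derive (x : R) (1 : R) q (dq x)) ->
  (\forall x \near (0 : R)^', x * dq x + a.+1%:R * q x = h x) ->
  Cn_at0 n q.
Proof.
elim: n a h q dq => [//|n IH] a h q dq cq nh qdq E.
have dh := Cn_at0S_derive nh.
have dhd : \forall x \near (0 : R)^', is_derive (x : R) (1 : R) h (derive1 h x).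
  exact: cvg_within dh.
pose b : R := a.+1%:R; pose dh0 := derive1 h 0.
pose p x := if x == 0 then dh0 / (b + 1) else (h x - b * q x) / x.
have pE x : x != 0 -> p x = (h x - b * q x) / x by rewrite /p => /negbTE->.
have dqp : \forall x \near (0 : R)^', dq x = p x.
  near=> x; have x0 : x != 0 by near: x; exact: nbhs_dnbhs_neq.
  by rewrite pE// -(near E x _)// addrK mulrC mulKf.
have dN : \forall x \near (0 : R)^',
    is_derive (x : R) (1 : R) (fun y => h y - b * q y) (derive1 h x - b * dq x).
  near=> x; apply: is_deriveB; first exact: (near dhd x).
  by apply: (is_deriveZ b (near qdq x _)).
pose dp x := (derive1 h x - (b + 1) * p x) / x.
have pdp : \forall x \near (0 : R)^', is_derive (x : R) (1 : R) p (dp x).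
  near=> x; have x0 : x != 0 by near: x; exact: nbhs_dnbhs_neq.
  apply: (@near_eq_is_derive _ _ _ (fun x => (h x - b * q x) / x)).
    near=> y; rewrite pE//.
    by near: y; exact: cvgr_neq0 x0.
  apply: is_derive_eq.
    apply: is_deriveM; first exact: (near dN x).
    exact: (@is_deriveV _ id).
  rewrite /dp (near dqp x _)// pE// /GRing.scale/=; field.
  exact: x0.
have b1 : b + 1 != 0 by rewrite /b natr1 pnatr_eq0.
have cp : {for 0, continuous p}.
  apply/continuous_withinNx.
  rewrite /p eqxx.
  have := @lhopital_dnbhs (fun x => x ^+ a.+1 * (h x - b * q x))
    (fun x => x ^+ a.+1 * derive1 h x) (fun x => x ^+ a.+2)
    (fun x => (b + 1) * x ^+ a.+1) (dh0 / (b + 1)).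
  move=> H; apply: cvg_trans (H _ _ _ _ _ _).
  - apply: near_eq_cvg; near=> x.
    have x0 : x != 0 by near: x; exact: nbhs_dnbhs_neq.
    rewrite -[RHS]/(p x) pE//.
    by rewrite [x ^+ a.+2]exprSr invfM mulrA [x ^+ _ * _]mulrC mulfK// expf_neq0.
  - near=> x; apply: is_derive_eq.
      apply: is_deriveM; first exact: is_derive_exprn.
      exact: (near dN x).
    by rewrite /GRing.scale /= -(near E x _)// -/b exprS; ring.
  - by near=> x; rewrite /b natr1; exact: is_derive_exprn.
  - near=> x; rewrite mulf_neq0// expf_neq0//.
    by near: x; exact: nbhs_dnbhs_neq.
  - rewrite -[X in _ --> X](_ : 0 ^+ a.+1 * (h 0 - b * q 0) = 0); last first.
      by rewrite expr0n mul0r.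
    apply: cvgM; first exact: exprn_continuous.
    apply: cvgB; first exact: Cn_at0_continuous nh.
    by apply: cvgM => //; exact: cvg_cst.
  - rewrite -[X in _ --> X](expr0n R a.+2); exact: exprn_continuous.
  - have : {for 0, continuous (derive1 h)} := Cn_at0_continuous nh.2.
    move=> /continuous_withinNx H1; apply: cvg_trans (cvgM H1 (cvg_cst (b + 1)^-1)).
    apply: near_eq_cvg; near=> x.
    have x0 : x != 0 by near: x; exact: nbhs_dnbhs_neq.
    by rewrite /= [(b + 1) * _]mulrC -mulf_div divff ?expf_neq0// mul1r.
have q0dq : \forall x \near (0 : R), is_derive (x : R) (1 : R) q (p x).
  have [e /= e0 He] : \forall x \near (0 : R)^', is_derive (x : R) (1 : R) q (p x).
    by near=> x; rewrite -(near dqp x _)//; exact: (near qdq x).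
  exists e => //= x xe; have [->|x0] := eqVneq x 0; last exact: He.
  apply/is_derive1_caratheodory.
  exists (fun z => if z == 0 then p 0 else (q z - q 0) / z); split; last by rewrite eqxx.
    by move=> z; rewrite subr0; case: eqVneq => [->|z0]; rewrite ?mulr0 ?subrr// divfK.
  apply/continuous_withinNx; rewrite eqxx.
  have := @lhopital_dnbhs (fun x => q x - q 0) p id (cst 1) (p 0).
  move=> H; apply: cvg_trans (H _ _ _ _ _ _).
  - apply: near_eq_cvg; near=> z.
    have /negbTE -> // : z != 0 by near: z; exact: nbhs_dnbhs_neq.
  - near=> z; rewrite -[p z]subr0; apply: is_deriveB; last exact: is_derive_cst.
    by rewrite -(near dqp z _)//; exact: (near qdq z).
  - by near=> z; exact: is_derive_id.
  - by near=> z; exact: oner_neq0.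
  - rewrite -[X in _ --> X](subrr (q 0)); apply: cvgB => //; exact: cvg_cst.
  - exact: cvg_id.
  - move/continuous_withinNx: cp; apply: cvg_trans; apply: near_eq_cvg; near=> z.
    by rewrite divr1.
apply: (Cn_at0S q0dq).
apply: (IH a.+1 (derive1 h) p dp) => //.
  exact: nh.2.
near=> x; have x0 : x != 0 by near: x; exact: nbhs_dnbhs_neq.
by rewrite /dp mulrC divfK// -natr1 -/b subrK.
Unshelve. all: by end_near. Qed.

(** Hadamard's lemma: differentiating h = x q gives x q' + q = h'. *)
Lemma Cn_at0_divX h q n : {for 0, continuous q} -> Cn_at0 n.+1 h ->
  (\forall x \near (0 : R), h x = x * q x) -> Cn_at0 n q.
Proof.
move=> cq nh hq.
have dh := Cn_at0S_derive nh.
have dhd : \forall x \near (0 : R)^', is_derive (x : R) (1 : R) h (derive1 h x).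
  exact: cvg_within dh.
have hqj : \forall x \near (0 : R), {near x, h =1 (fun y => y * q y)}.
  exact: (nbhs_interior hq).
pose dq x := (derive1 h x - q x) / x.
apply: (@Cn_at0_euler_div 0 (derive1 h) q dq) => //; first exact: nh.2.
  near=> x; have x0 : x != 0 by near: x; exact: nbhs_dnbhs_neq.
  apply: (@near_eq_is_derive _ _ _ (fun y => h y / y)).
    near=> y; have y0 : y != 0 by near: y; exact: cvgr_neq0 x0.
    have -> : h y = y * q y.
      near: y; near: x; exact: cvg_within hqj.
    by rewrite mulrAC divff// mul1r.
  apply: is_derive_eq.
    apply: is_deriveM; last exact: (@is_deriveV _ id).
    exact: (near dhd x).
  have -> : h x = x * q x by near: x; exact: cvg_within hq.
  by rewrite /GRing.scale /dq /=; field.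
near=> x; have x0 : x != 0 by near: x; exact: nbhs_dnbhs_neq.
by rewrite /dq mulrC divfK// mul1r subrK.
Unshelve. all: by end_near. Qed.

(** * Inverse functions and the slow drift *)

(** The derivative of psi is known at the points phi(x); these fill a
    neighbourhood of 0 because phi (psi y) = y there and psi is continuous at
    0. *)
Lemma near_is_derive_inverse phi psi n : Cn_at0 n.+1 phi -> phi 0 = 0 ->
  derive1 phi 0 != 0 -> local_inverse0 phi psi ->
  psi 0 = 0 /\
  \forall y \near (0 : R), is_derive (y : R) (1 : R) psi (derive1 phi (psi y))^-1.
Proof.
move=> nphi phi0 dphi0 [psiK phiK].
have psi0 : psi 0 = 0 by rewrite -{1}phi0 (nbhs_singleton psiK).
have dphi := Cn_at0S_derive nphi.
have cphi : \forall x \near (0 : R), {for x, continuous phi}.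
  near=> x; apply: differentiable_continuous; apply/derivable1_diffP.
  by apply: ex_derive; exact: (near dphi x).
have jcphi : \forall x \near (0 : R), {near x, continuous phi}.
  exact: nbhs_interior cphi.
have jpsiK : \forall x \near (0 : R), {near x, cancel phi psi}.
  exact: nbhs_interior psiK.
have dpsi0 := is_derive_inverse (nbhs_singleton jpsiK) (nbhs_singleton jcphi)
  (nbhs_singleton dphi) dphi0.
have cpsi : psi y @[y --> (0 : R)] --> (0 : R).
  rewrite -[X in _ --> X]psi0; apply: differentiable_continuous.
  by apply/derivable1_diffP; move: dpsi0; rewrite phi0 => -[].
split => //.
have A : \forall x \near (0 : R),
    is_derive (phi x) (1 : R) psi (derive1 phi x)^-1.
  have cphi' := Cn_at0_continuous nphi.2.
  have nz : \forall x \near (0 : R), derive1 phi x != 0.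
    exact: cvgr_neq0 cphi' dphi0.
  near=> x; apply: is_derive_inverse.
  - exact: (near jpsiK x).
  - exact: (near jcphi x).
  - exact: (near dphi x).
  - by near: x.
have {}A : \forall y \near (0 : R),
    is_derive (phi (psi y)) (1 : R) psi (derive1 phi (psi y))^-1 := cpsi _ A.
near=> y.
rewrite -[X in is_derive X](_ : phi (psi y) = y); last by near: y.
exact: (near A y).
Unshelve. all: by end_near. Qed.

Lemma Cn_at0_inverse phi psi n : Cn_at0 n.+1 phi -> phi 0 = 0 ->
  derive1 phi 0 != 0 -> local_inverse0 phi psi -> Cn_at0 n.+1 psi.
Proof.
elim: n => [|n IH] nphi phi0 dphi0 pK.
  have [psi0 dpsi] := near_is_derive_inverse nphi phi0 dphi0 pK.
  apply: (Cn_at0S dpsi); apply: Cn_at0V; rewrite ?psi0//.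
  apply: (@Cn_at0_comp (derive1 phi)) => //; first exact: nphi.2.
  apply: differentiable_continuous; apply/derivable1_diffP.
  by case: (nbhs_singleton dpsi).
have [psi0 dpsi] := near_is_derive_inverse nphi phi0 dphi0 pK.
apply: (Cn_at0S dpsi); apply: Cn_at0V; rewrite ?psi0//.
apply: (@Cn_at0_comp (derive1 phi)) => //; first exact: nphi.2.
by apply: IH => //; exact: Cn_at0W.
Qed.

(** The drift G(psi) psi' is smooth, and its slope at 0 is G'(0) psi'(0)^2 since
    G(0) = 0. *)
Lemma slow_drift_at0 (f G psi : R -> R) :
  smooth_near0 (fun x => x ^+ 2 * f x) -> {for 0, continuous f} -> 0 < f 0 ->
  smooth_near0 G -> G 0 = 0 -> derive1 G 0 < 0 ->
  local_inverse0 (fun x => x * Num.sqrt (f x)) psi ->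
  [/\ forall n, Cn_at0 n (slow_drift G psi), slow_drift G psi 0 = 0 &
      derive1 (slow_drift G psi) 0 < 0].
Proof.
move=> sF cf f0 sG G0 dG0 pK.
have nf n : Cn_at0 n f.
  apply: (@Cn_at0_divX (fun x => x * f x)) => //; last by near=> x.
  apply: (@Cn_at0_divX (fun x => x ^+ 2 * f x)).
  - by apply: continuousM => //; exact: cvg_id.
  - exact: smooth_Cn_at0.
  - by near=> x; rewrite expr2 mulrA.
set phi := fun x => _ in pK.
have nphi n : Cn_at0 n phi.
  by apply: (Cn_at0M (Cn_at0_id n)); exact: Cn_at0_sqrt.
have phi0 : phi 0 = 0 by rewrite /phi mul0r.
have dphi : is_derive (0 : R) (1 : R) phi (Num.sqrt (f 0)).
  apply/is_derive1_caratheodory; exists (fun x => Num.sqrt (f x)); split => //.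
    by move=> z; rewrite phi0 !subr0 mulrC.
  exact: (Cn_at0_continuous (Cn_at0_sqrt f0 (nf 0%N))).
have dphi0 : derive1 phi 0 != 0.
  by rewrite derive1E derive_val gt_eqF// sqrtr_gt0.
have npsi n : Cn_at0 n psi.
  exact: Cn_at0W (Cn_at0_inverse (nphi n.+1) phi0 dphi0 pK).
have [psi0 dpsi] := near_is_derive_inverse (nphi 1%N) phi0 dphi0 pK.
have nG n : Cn_at0 n G by exact: smooth_Cn_at0.
have nD n : Cn_at0 n (slow_drift G psi).
  by apply: (@Cn_at0M (G \o psi)); [exact: Cn_at0_comp|exact: (npsi n.+1).2].
have D0 : slow_drift G psi 0 = 0 by rewrite /slow_drift psi0 G0 mul0r.
split => //.
have d1 := nbhs_singleton dpsi; rewrite psi0 in d1.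
have d2 := nbhs_singleton (Cn_at0S_derive (nG 1%N)).
have ndpsi : Cn_at0 1 (derive1 psi) := (npsi 2%N).2.
have d3 := nbhs_singleton (Cn_at0S_derive ndpsi).
have d12 : is_derive (0 : R) (1 : R) (G \o psi) (derive1 G 0 * (derive1 phi 0)^-1).
  by apply: is_derive1_comp; rewrite psi0.
have := is_deriveM d12 d3.
move=> /@derive_val; rewrite -derive1E /= => ->.
rewrite psi0 G0 scale0r add0r /GRing.scale /= [derive1 psi 0]derive1E derive_val.
by rewrite mulrCA pmulr_llt0// -expr2 exprn_even_gt0//= invr_neq0.
Unshelve. all: by end_near. Qed.

End germs.

(** * Neighbourhoods of sequences and Minkowski contents *)

Section contents.
Context {R : realType}.
Implicit Types (U : set R) (d e s x y M k kap c C al eta r : R) (u : nat -> R).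
Local Notation mu := (@lebesgue_measure R).

Lemma powRD_gt0 x r s : 0 < x -> x `^ (r + s) = x `^ r * x `^ s.
Proof. by move=> x0; rewrite powRD// (gt_eqF x0) implybT. Qed.

Lemma measurable_closed_nbhd U d : measurable (closed_nbhd U d).
Proof.
apply: closed_measurable.
have /continuousP cE := @edist_inf_continuous R R U.
rewrite -openC.
have := cE _ (closed_openC (@closed_ereal_ge_ereal R d%:E)).
by congr open; apply/seteqP; split.
Qed.

Lemma closed_nbhd_close U d x y : U y -> `|x - y| <= d -> closed_nbhd U d x.
Proof.
move=> Uy xyd; rewrite /closed_nbhd /=.
apply: (@le_trans _ _ (edist (x, y))).
  by apply: ereal_inf_lbound; exists y.
apply/lee_addgt0Pr => e e0; rewrite -EFinD.
apply: edist_fin; first by rewrite ltr_wpDl// (le_trans _ xyd).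
by rewrite /ball/= (le_lt_trans xyd)// ltrDl.
Qed.

(** The infimum defining the distance to U need not be attained, hence the
    larger radius e. *)
Lemma closed_nbhd_near U d e x : d < e -> closed_nbhd U d x ->
  exists2 y, U y & `|x - y| < e.
Proof.
move=> de xU.
have : (edist_inf U x < e%:E)%E by rewrite (le_lt_trans xU)// lte_fin.
move=> /ereal_inf_lt[_ [y Uy <-]] /edist_lt_ball xy.
by exists y.
Qed.

Lemma limf_esup_le (f : R -> \bar R) (F : set_system R) (c : \bar R) :
  (\forall x \near F, (f x <= c)%E) -> (limf_esup f F <= c)%E.
Proof.
move=> Ff; rewrite limf_esupE.
apply: (@le_trans _ _ (ereal_sup (f @` [set x | (f x <= c)%E]))).
  by apply: ereal_inf_lbound; exists [set x | (f x <= c)%E].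
by apply: ge_ereal_sup => _ [x /= fx <-].
Qed.

Lemma limf_einf_ge (f : R -> \bar R) (F : set_system R) (c : \bar R) :
  (\forall x \near F, (c <= f x)%E) -> (c <= limf_einf f F)%E.
Proof.
move=> Ff; rewrite limf_einfE.
apply: (@le_trans _ _ (ereal_inf (f @` [set x | (c <= f x)%E]))).
  by apply: le_ereal_inf_tmp => _ [x /= fx <-].
by apply: ereal_sup_ubound; exists [set x | (c <= f x)%E].
Qed.

Lemma limf_einf_le_esup (f : R -> \bar R) (F : set_system R) {PF : ProperFilter F} :
  (limf_einf f F <= limf_esup f F)%E.
Proof.
rewrite limf_einfE limf_esupE.
apply: ge_ereal_sup => _ [V FV <-]; apply: le_ereal_inf_tmp => _ [W FW <-].
have [x [Vx Wx]] := filter_ex (filterI FV FW).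
apply: (@le_trans _ _ (f x)).
  by apply: ereal_inf_lbound; exists x.
by apply: ereal_sup_ubound; exists x.
Qed.

Lemma minkowski_ratio_ge0 s U d : (0 <= minkowski_ratio s U d)%E.
Proof. by apply: mule_ge0; rewrite ?measure_ge0// lee_fin invr_ge0 powR_ge0. Qed.

Lemma lower_content_ge0 s U : (0 <= lower_content s U)%E.
Proof.
apply: limf_einf_ge; near=> x; exact: minkowski_ratio_ge0.
Unshelve. all: by end_near. Qed.

Lemma lower_content_le_upper s U : (lower_content s U <= upper_content s U)%E.
Proof. exact: limf_einf_le_esup. Qed.

Lemma upper_content_le U M e :
  (\forall d \near (0 : R)^'+, (mu (closed_nbhd U d) <= (M * d `^ e)%:E)%E) ->
  (upper_content (1 - e) U <= M%:E)%E.
Proof.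
move=> H; apply: limf_esup_le; near=> d.
have d0 : 0 < d by near: d; exact: nbhs_right_gt.
rewrite /minkowski_ratio subKr.
have de0 : 0 < d `^ e by exact: powR_gt0.
apply: le_trans (lee_wpmul2r _ (near H d _)) _ => //.
  by rewrite lee_fin invr_ge0 ltW.
by rewrite -EFinM mulfK// gt_eqF.
Unshelve. all: by end_near. Qed.

Lemma upper_content_eq0 U M e s :
  (\forall d \near (0 : R)^'+, (mu (closed_nbhd U d) <= (M * d `^ e)%:E)%E) ->
  1 - e < s -> upper_content s U = 0%E.
Proof.
move=> H es; apply/eqP; rewrite eq_le; apply/andP; split; last first.
  exact: le_trans (lower_content_ge0 s U) (lower_content_le_upper s U).
apply/lee_addgt0Pr => c c0; rewrite add0e; apply: limf_esup_le.
pose t := e - (1 - s).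
have t0 : 0 < t by rewrite subr_gt0 ltrBlDr addrC -ltrBlDr.
pose m := c / (`|M| + 1).
have M0 : 0 < `|M| + 1 by rewrite ltr_wpDl.
have m0 : 0 < m by exact: divr_gt0.
near=> d.
have d0 : 0 < d by near: d; exact: nbhs_right_gt.
have dt : d `^ t <= m.
  rewrite -[m]powRr1 ?(ltW m0)// -(mulVf (lt0r_neq0 t0)) powRrM.
  apply: ge0_ler_powR; rewrite ?nnegrE ?powR_ge0 ?(ltW t0) ?(ltW d0)//.
  by near: d; apply: nbhs_right_le; exact: powR_gt0.
rewrite /minkowski_ratio.
apply: le_trans (lee_wpmul2r _ (near H d _)) _ => //.
  by rewrite lee_fin invr_ge0 powR_ge0.
rewrite -EFinM lee_fin -mulrA -powRN -powRD_gt0//.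
rewrite -/t (le_trans (ler_wpM2r (powR_ge0 _ _) (ler_norm M)))//.
apply: (@le_trans _ _ ((`|M| + 1) * d `^ t)).
  by rewrite ler_wpM2r ?powR_ge0// lerDl.
by rewrite mulrC -ler_pdivlMr.
Unshelve. all: by end_near. Qed.

Lemma lower_content_ge U k e s :
  (\forall d \near (0 : R)^'+, ((k * d `^ e)%:E <= mu (closed_nbhd U d))%E) ->
  0 < k -> s <= 1 - e -> (k%:E <= lower_content s U)%E.
Proof.
move=> H k0 se; apply: limf_einf_ge; near=> d.
have d0 : 0 < d by near: d; exact: nbhs_right_gt.
have d1 : d <= 1 by near: d; exact: nbhs_right_le.
have ds : 0 < d `^ (1 - s) by exact: powR_gt0.
rewrite /minkowski_ratio.
apply: le_trans (lee_wpmul2r _ (near H d _)) => //; last first.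
  by rewrite lee_fin invr_ge0 ltW.
rewrite -EFinM lee_fin -mulrA ler_peMr ?(ltW k0)// ler_pdivlMr// mul1r.
by apply: ger_powR; rewrite ?d0 ?d1// lerBrDr addrC -lerBrDr.
Unshelve. all: by end_near. Qed.

(** One criterion serves for both dimensions, as the lower content is at most
    the upper one. *)
Lemma has_minkowski_dim_of U d : 0 <= d ->
  (forall s, d < s -> upper_content s U = 0%E) ->
  (forall s, 0 <= s -> s < d -> (0 < lower_content s U)%E) ->
  has_minkowski_dim U d.
Proof.
move=> d0 up lo.
have infE (S : set R) : (forall s, S s -> 0 <= s) -> (forall s, d < s -> S s) ->
    (forall s, 0 <= s -> s < d -> ~ S s) -> inf S = d.
  move=> S0 Sd Sn.
  have lb : lbound S d.
    by move=> s Ss; rewrite leNgt; apply/negP => sd; apply: (Sn s) => //; exact: S0.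
  apply/eqP; rewrite eq_le; apply/andP; split.
    apply/ler_addgt0Pr => e e0; apply: ge_inf; first by exists d.
    by apply: Sd; rewrite ltrDl.
  by apply: lb_le_inf => //; exists (d + 1); apply: Sd; rewrite ltrDl.
split; (apply: infE => [s []//|s ds|s s0 sd [_]]).
- split; first exact: le_trans (ltW ds).
  apply/eqP; rewrite eq_le lower_content_ge0 andbT -(up _ ds).
  exact: lower_content_le_upper.
- by move: (lo s s0 sd) => /[swap] ->; rewrite ltxx.
- by split; [exact: le_trans (ltW ds)|exact: up].
- have := lt_le_trans (lo s s0 sd) (lower_content_le_upper s U).
  by move=> /[swap] ->; rewrite ltxx.
Qed.

Variable u : nat -> R.
Hypothesis u0 : forall l, 0 < u l.

(** The first n points contribute n intervals, and all the others lie in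
    [0, u n].  Radius 2 d is used instead of d because of [closed_nbhd_near]. *)
Lemma closed_nbhd_measure_le n d : nonincreasing_seq u -> 0 < d ->
  (mu (closed_nbhd (range u) d) <= (u n + 4 * n.+1%:R * d)%:E)%E.
Proof.
move=> ud d0.
pose B (c r : R) : set R := `[c - r, c + r]%classic.
have muB c r : 0 <= r -> mu (B c r) = (2 * r)%:E.
  rewrite lebesgue_measure_itv/= lte_fin; case: ltP => [_ _|rr r0].
    by rewrite -EFinB; congr (_%:E); ring.
  by have -> : r = 0 :> R; [lra|rewrite mulr0].
pose N := `[- (2 * d), u n + 2 * d]%classic.
have muN : mu N = (u n + 4 * d)%:E.
  rewrite lebesgue_measure_itv/= lte_fin ifT; last by have := u0 n; lra.
  by rewrite -EFinB; congr (_%:E); ring.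
pose T := \big[setU/set0]_(i < n) B (u i) (2 * d).
have sub : closed_nbhd (range u) d `<=` N `|` T.
  move=> x /(@closed_nbhd_near _ _ (2 * d)) [|_ [l _ <-] xl]; first lra.
  have [nl|ln] := leqP n l.
    left; rewrite /N/= in_itv/=; have := ud _ _ nl; have := u0 l.
    by move: xl; rewrite ltr_norml => /andP[]; lra.
  right; rewrite /T -(bigcup_mkord n (fun i => B (u i) (2 * d))); exists l => //=.
  by rewrite /B/= in_itv/=; move: xl; rewrite ltr_norml => /andP[]; lra.
have mT : measurable T by apply: bigsetU_measurable => i _; exact: measurable_itv.
apply: (@le_trans _ _ (mu (N `|` T))).
  apply: le_measure => //; rewrite inE; first exact: measurable_closed_nbhd.
  by apply: measurableU => //; exact: measurable_itv.
apply: (@le_trans _ _ (mu N + mu T)%E).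
  by apply: measureU2 => //; exact: measurable_itv.
have muT : (mu T <= (n%:R * (4 * d))%:E)%E.
  have mB i : (i < n)%N -> measurable (B (u i) (2 * d)).
    by move=> _; exact: measurable_itv.
  apply: le_trans (@Boole_inequality _ _ _ mu (fun i => B (u i) (2 * d)) n mB) _.
  rewrite (eq_bigr (fun=> (2 * (2 * d))%:E)); last first.
    by move=> i _; rewrite /= muB// mulr_ge0// ltW.
  rewrite sumEFin lee_fin big_const card_ord iter_addr addr0.
  have -> : 2 * (2 * d) *+ n = n%:R * (2 * (2 * d)) by rewrite [RHS]mulr_natl.
  by have -> : 4 * d = 2 * (2 * d) by ring.
apply: le_trans (leeD (lexx _) muT) _.
rewrite muN -EFinD lee_fin -natr1; lra.
Qed.

Lemma sub_closed_nbhd_measure_ge U r d : 0 < r ->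
  (forall x, 0 < x <= r -> exists2 y, U y & `|x - y| <= d) ->
  (r%:E <= mu (closed_nbhd U d))%E.
Proof.
move=> r0 H.
have <- : mu `]0, r] = r%:E by rewrite lebesgue_measure_itv/= lte_fin r0 sube0.
apply: le_measure; rewrite ?inE//; first exact: measurable_closed_nbhd.
move=> x /=; rewrite in_itv/= => /H[y Uy xy].
exact: closed_nbhd_close xy.
Qed.

(** With b = al - 1, the gap condition makes u^(-b) grow by at least b c at each
    step, so u_n = O(n^(-1/b)).  Taking n of order d^(-(1 - 1/al)) balances the
    two terms u_n and n d of [closed_nbhd_measure_le]: both become of order
    d^(1/al). *)
Lemma powerlaw_gap_measure_le c al : nonincreasing_seq u -> 0 < c -> 1 < al ->
  (forall l, c * u l `^ al <= u l - u l.+1) ->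
  exists M, \forall d \near (0 : R)^'+,
    (mu (closed_nbhd (range u) d) <= (M * d `^ al^-1)%:E)%E.
Proof.
move=> ud c0 al1 gap.
pose b := al - 1; have b0 : 0 < b by rewrite subr_gt0.
(* From u_{l+1} <= u_l (1 - t), t = c u_l^b, one gets
   u_{l+1}^(-b) >= u_l^(-b) e^(b t) >= u_l^(-b) (1 + b t). *)
have grow l : u l `^ (- b) + b * c <= u l.+1 `^ (- b).
  have ul := u0 l; have ul1 := u0 l.+1.
  pose t := c * u l `^ b.
  have tE : u l * t = c * u l `^ al.
    rewrite /t mulrCA; congr (_ * _).
    by rewrite -[X in X * _]powRr1 ?ltW// -powRD_gt0// /b addrC subrK.
  have u1 : u l.+1 <= u l * (1 - t) by have := gap l; rewrite -tE; lra.
  have t1 : 0 < 1 - t by rewrite -(pmulr_rgt0 _ ul); lra.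
  have lnle : ln (u l.+1) <= ln (u l) - t.
    apply: (@le_trans _ _ (ln (u l * (1 - t)))).
      by rewrite ler_ln// posrE// mulr_gt0.
    rewrite lnM ?posrE// lerD2l; apply: le_ln1Dx; lra.
  have -> : u l.+1 `^ (- b) = expR (- b * ln (u l.+1)) by rewrite /powR gt_eqF.
  apply: (@le_trans _ _ (expR (- b * (ln (u l) - t)))); last first.
    by rewrite ler_expR !mulNr lerN2 ler_pM2l.
  have -> : - b * (ln (u l) - t) = - b * ln (u l) + b * t by ring.
  rewrite expRD.
  have -> : expR (- b * ln (u l)) = u l `^ (- b) by rewrite /powR gt_eqF.
  apply: (@le_trans _ _ (u l `^ (- b) * (1 + b * t))); last first.
    by rewrite ler_wpM2l ?powR_ge0// expR_ge1Dx.
  have E : u l `^ (- b) * u l `^ b = 1 by rewrite -powRD_gt0// addNr powRr0.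
  rewrite mulrDr mulr1 lerD2l /t.
  have -> : u l `^ (- b) * (b * (c * u l `^ b)) =
            b * c * (u l `^ (- b) * u l `^ b) by ring.
  by rewrite E mulr1.
have lin n : n%:R * (b * c) <= u n `^ (- b).
  elim: n => [|n IH]; first by rewrite mul0r powR_ge0.
  by rewrite -natr1 mulrDl mul1r; apply: le_trans (grow n); rewrite lerD2r.
exists ((b * c)^-1 `^ b^-1 + 12).
near=> d.
have d0 : 0 < d by near: d; exact: nbhs_right_gt.
have d1 : d <= 1 by near: d; exact: nbhs_right_le.
pose X := d `^ (- (1 - al^-1)).
have X0 : 0 < X by exact: powR_gt0.
have al0 : 0 < al by lra.
have ali : 1 - al^-1 = b / al by rewrite /b mulrBl divff ?gt_eqF// mul1r.
have X1 : 1 <= X.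
  rewrite /X powRN invf_ge1 ?powR_gt0//.
  have : d `^ (1 - al^-1) <= 1 `^ (1 - al^-1).
    apply: ge0_ler_powR; rewrite ?nnegrE ?(ltW d0)//.
    by rewrite ali divr_ge0// ltW.
  by rewrite powR1.
have Xd : X * d = d `^ al^-1.
  rewrite /X -{2}[d]powRr1 ?ltW// -powRD_gt0//; congr (_ `^ _); ring.
pose n := (Num.truncn X).+1.
have Xn : X <= n%:R by rewrite ltW// truncnS_gt.
have nX : n%:R <= X + 1.
  by rewrite /n -natr1 lerD2r truncn_le ltW.
clearbody n.
apply: le_trans (closed_nbhd_measure_le n ud d0) _; rewrite lee_fin [leRHS]mulrDl.
apply: lerD; last first.
  have n12 : 4 * n.+1%:R <= 12 * X by rewrite -natr1; lra.
  by rewrite -Xd [leRHS]mulrA; apply: ler_wpM2r => //; exact: ltW.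
have un := u0 n.
have K : (X * (b * c)) <= (u n `^ b)^-1.
  rewrite -powRN; apply: le_trans (lin n).
  by rewrite ler_wpM2r// mulr_ge0// ltW.
have {}K : u n `^ b <= (X * (b * c))^-1.
  by rewrite -[X in X <= _]invrK lef_pV2// posrE ?invr_gt0 ?powR_gt0// !mulr_gt0.
have -> : u n = (u n `^ b) `^ b^-1.
  by rewrite -powRrM divff ?gt_eqF// powRr1// ltW.
have -> : d `^ al^-1 = X^-1 `^ b^-1.
  by rewrite /X -powRN -powRrM opprK ali mulrAC divff ?gt_eqF// mul1r.
have bc0 : 0 < b * c by exact: mulr_gt0.
rewrite -powRM ?invr_ge0 ?(ltW bc0) ?(ltW X0)//.
apply: ge0_ler_powR; rewrite ?nnegrE ?invr_ge0 ?powR_ge0 ?(ltW b0)//.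
  by rewrite mulr_ge0 ?invr_ge0 ?(ltW bc0) ?(ltW X0).
by rewrite -invfM mulrC.
Unshelve. all: by end_near. Qed.

(** A point x of ]0, kap r] lies between two consecutive terms; the ratio
    condition bounds the larger one by r = (d / C)^(1/al), so that their gap is
    at most C r^al = d.  Hence ]0, kap r] is contained in the
    d-neighbourhood. *)
Lemma powerlaw_gap_measure_ge kap C al eta :
  u @ \oo --> 0 ->
  0 < kap -> 0 < C -> 0 < al -> 0 < eta ->
  (forall l, kap * u l <= u l.+1) ->
  (forall l, u l < eta -> u l - u l.+1 <= C * u l `^ al) ->
  exists2 k, 0 < k & \forall d \near (0 : R)^'+,
    ((k * d `^ al^-1)%:E <= mu (closed_nbhd (range u) d))%E.
Proof.
move=> ucvg kap0 C0 al0 eta0 ratio gap.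
pose k := kap * C^-1 `^ al^-1.
have k0 : 0 < k by rewrite mulr_gt0 ?powR_gt0 ?invr_gt0.
exists k => //; near=> d.
have d0 : 0 < d by near: d; exact: nbhs_right_gt.
pose r := (d / C) `^ al^-1.
have r0 : 0 < r by rewrite powR_gt0// divr_gt0.
have rE : k * d `^ al^-1 = kap * r.
  by rewrite /k /r powRM ?invr_ge0 ?ltW// [d `^ _ * _]mulrC mulrA.
have rd : C * r `^ al = d.
  rewrite /r -powRrM mulVf ?gt_eqF// powRr1 ?ltW ?divr_gt0//.
  by rewrite mulrC divfK// gt_eqF.
have small m : 0 < m -> d < m `^ al * C -> r < m.
  move=> m0 dm; rewrite -[m]powRr1 ?ltW// -(divff (lt0r_neq0 al0)) powRrM.
  by apply: gt0_ltr_powR; rewrite ?nnegrE ?invr_gt0 ?powR_ge0 ?ltW ?divr_gt0 ?ltr_pdivrMr.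
have reta : r < eta.
  apply: small => //; near: d; by apply: nbhs_right_lt; rewrite mulr_gt0// powR_gt0.
have ru0 : kap * r < u 0%N.
  rewrite mulrC -ltr_pdivlMr//; apply: small; first by rewrite divr_gt0.
  by near: d; apply: nbhs_right_lt; rewrite mulr_gt0// powR_gt0// divr_gt0.
rewrite rE; apply: sub_closed_nbhd_measure_ge; first exact: mulr_gt0.
move=> x /andP[x0 xr].
have [N uN] : exists N, u N < x.
  have /(_ _) := cvgr_lt _ ucvg x x0 => -[N _ HN].
  by exists N; apply: HN => /=.
have exN : exists N, u N < x by exists N.
case: (ex_minnP exN) => -[|l] ul min.
  by move: (lt_le_trans ul xr); rewrite ltNge (ltW ru0).
have xl : x <= u l by rewrite leNgt; apply/negP => /min; rewrite ltnn.
exists (u l); first by exists l.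
have ulr : u l < r.
  rewrite -(ltr_pM2l kap0); apply: le_lt_trans (ratio l) _.
  exact: lt_le_trans ul xr.
rewrite distrC ger0_norm ?subr_ge0//.
apply: (@le_trans _ _ (u l - u l.+1)); first by rewrite lerD2l lerN2 ltW.
apply: le_trans (gap l _) _; first exact: lt_trans reta.
rewrite -rd ler_pM2l//; apply: ge0_ler_powR; rewrite ?nnegrE ?ltW//.
Unshelve. all: by end_near. Qed.

End contents.

(** * Orbits of a slow relation *)

Definition decreasing_bilipschitz (R : realType) (a A b : R) (f : R -> R) :=
  forall z y, 0 <= z -> z <= y -> y < b ->
  a * (y - z) <= f z - f y <= A * (y - z).

Section bilipschitz.
Context {R : realType}.
Variables (a A b : R) (f : R -> R).
Hypotheses (a0 : 0 < a) (flip : decreasing_bilipschitz a A b f).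

Lemma bilipschitz_A_gt0 : 0 < b -> 0 < A.
Proof.
move=> b0; have h0 : 0 < b / 2 by lra.
have /andP[h1 h2] : a * (b / 2 - 0) <= f 0 - f (b / 2) <= A * (b / 2 - 0).
  by apply: flip => //; [exact: ltW|lra].
rewrite subr0 in h1 h2.
rewrite -(pmulr_lgt0 _ h0); apply: lt_le_trans (le_trans h1 h2).
exact: mulr_gt0.
Qed.

Lemma bilipschitz_dist x y : 0 <= x < b -> 0 <= y < b ->
  `|f x - f y| <= A * `|x - y|.
Proof.
wlog xy : x y / x <= y.
  move=> H xb yb; have [xy|/ltW yx] := leP x y; first exact: H.
  by rewrite distrC (distrC x); exact: H.
move=> /andP[x0 _] /andP[_ yb]; have /andP[h1 h2] := flip x0 xy yb.
rewrite [`|x - y|]distrC [X in _ <= _ * X]ger0_norm ?subr_ge0// ger0_norm//.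
by apply: le_trans h1; rewrite mulr_ge0 ?(ltW a0)// subr_ge0.
Qed.

Lemma bilipschitz_inj x y : 0 <= x < b -> 0 <= y < b -> f x = f y -> x = y.
Proof.
wlog xy : x y / x <= y.
  move=> H xb yb E; have [xy|/ltW yx] := leP x y; first exact: H.
  by apply/esym; apply: H.
move=> /andP[x0 _] /andP[_ yb] E; apply/eqP; rewrite eq_le xy/= -subr_le0.
have := flip x0 xy yb; rewrite E subrr => /andP[+ _].
by rewrite pmulr_rle0.
Qed.

Lemma bilipschitz_continuous y : 0 <= y < b -> {within `[0, y], continuous f}.
Proof.
move=> /andP[y0 yb].
have A0 : 0 < A by apply: bilipschitz_A_gt0; exact: le_lt_trans yb.
apply/subspace_continuousP => x /=.
rewrite in_itv/= => /andP[x0 xy].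
apply/cvgrPdist_le => e e0; near=> t.
have : t \in `[0, y] by near: t; exact: withinT.
rewrite in_itv/= => /andP[t0 ty].
apply: (le_trans (bilipschitz_dist _ _)).
- by rewrite x0 (le_lt_trans xy).
- by rewrite t0 (le_lt_trans ty).
rewrite mulrC -ler_pdivlMr//; near: t; apply: cvg_within.
by have /cvgrPdist_le := @cvg_id _ (nbhs x); apply; exact: divr_gt0.
Unshelve. all: by end_near. Qed.

End bilipschitz.

(** The orbits below solve P(y_{l+1}) = Q(y_l) with P < Q.  For the orbits of H
    one takes P = I_- and Q = I_+, for those of its inverse P = I_+ and
    Q = I_-. *)
Section dynamics.
Context {R : realType}.
Variables (a A ystar : R) (P Q : R -> R).
Hypotheses (a0 : 0 < a).
Hypotheses (Plip : decreasing_bilipschitz a A ystar P)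
  (Qlip : decreasing_bilipschitz a A ystar Q).
Hypotheses (P0 : P 0 = 0) (Q0 : Q 0 = 0).
Hypothesis PQ : forall y, 0 < y < ystar -> P y < Q y.
Variable y0 : R.
Hypothesis y0P : 0 < y0 < ystar.

Let ys0 : 0 < ystar.
Proof. by case/andP: y0P => /lt_trans; exact. Qed.

Let A0 : 0 < A. Proof. exact: bilipschitz_A_gt0 Plip ys0. Qed.

Lemma orbit_step y : 0 < y < ystar -> exists2 z, 0 < z < y & P z = Q y.
Proof.
move=> ys; have /andP[y00 yy] := ys.
have Qy : Q y < 0.
  have /andP[+ _] := Qlip (lexx 0) (ltW y00) yy; rewrite Q0 subr0 sub0r.
  by rewrite lerNr => h; rewrite (le_lt_trans h)// oppr_lt0 mulr_gt0.
have := PQ ys => PQy.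
have cP : {within `[0, y], continuous P}.
  by apply: (bilipschitz_continuous a0 Plip); rewrite (ltW y00).
have [|z] := IVT (v := Q y) (ltW y00) cP.
  by rewrite P0 ge_min le_max (ltW PQy) orbT (ltW Qy).
rewrite in_itv/= => /andP[z0 zy] Pz; exists z => //.
rewrite !lt_neqAle z0 zy !andbT; apply/andP; split; apply/eqP => E.
  by move: Qy; rewrite -Pz -E P0 ltxx.
by move: PQy; rewrite -Pz E ltxx.
Qed.

(** At a positive limit L of the orbit, P(L) = Q(L) by continuity, against
    P < Q. *)
Lemma orbit_exists : exists u,
  [/\ unique (is_orbit (slow_relation ystar P Q) y0) u,
      forall l, 0 < u l < ystar,
      nonincreasing_seq u, u @ \oo --> 0 &
      forall l, P (u l.+1) = Q (u l)].
Proof.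
have ex y : exists z, 0 < y < ystar -> 0 < z < y /\ P z = Q y.
  have [/orbit_step[z ? ?]|_] := boolP (0 < y < ystar); first by exists z.
  by exists 0.
have [h hP] := choice ex.
pose u l := iter l h y0.
have uI l : 0 < u l < ystar.
  elim: l => // l IH; have [/andP[h0 hu] _] := hP _ IH.
  by rewrite /u iterS h0 (lt_trans hu)//; case/andP: IH.
have ud : nonincreasing_seq u.
  apply/nonincreasing_seqP => l; have [/andP[_ +] _] := hP _ (uI l).
  exact: ltW.
have uE l : P (u l.+1) = Q (u l) by have [_ ->] := hP _ (uI l).
exists u; split => //.
- split; first by split=> // l; split.
  move=> v [v0 vr]; apply/funext; elim=> [|l IH]; first by rewrite v0.
  have [vs vE] := vr l; apply: (bilipschitz_inj a0 Plip).
  - by case/andP: (uI l.+1) => /ltW -> ->.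
  - by case/andP: vs => /ltW -> ->.
  - by rewrite uE vE IH.
have ucvg : cvgn u.
  apply: nonincreasing_is_cvgn => //; exists 0 => _ [l _ <-].
  by have /andP[/ltW] := uI l.
have Lu := nonincreasing_cvgn_ge ud ucvg.
suff L0 : limn u = 0 by rewrite -L0.
have : 0 <= limn u.
  by apply: limr_ge => //; near=> l; have /andP[/ltW] := uI l.
rewrite le_eqVlt => /predU1P[//|L0].
set L := limn u in Lu L0 *.
have Ls : 0 < L < ystar.
  by rewrite L0 (le_lt_trans (Lu 0%N))//; case/andP: (uI 0%N).
(* Q L - P L <= (Q L - Q (u l)) + (P (u l.+1) - P L) <= A (u l - L), which is
   smaller than Q L - P L as soon as u l is close enough to L. *)
have PQL := PQ Ls.
have : \forall l \near \oo, u l < L + (Q L - P L) / (2 * A).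
  by apply: cvgr_lt ucvg _ _; rewrite ltrDl divr_gt0 ?subr_gt0// mulr_gt0.
move=> [l _ /(_ l (leqnn l))]; rewrite /= -ltrBlDl ltr_pdivlMr ?mulr_gt0// => uL.
have /andP[h1 _] := Plip (ltW L0) (Lu l.+1) (andP (uI l.+1)).2.
have /andP[_ h2] := Qlip (ltW L0) (Lu l) (andP (uI l)).2.
have h3 : 0 <= a * (u l.+1 - L) by rewrite mulr_ge0 ?(ltW a0)// subr_ge0.
have h4 : 0 <= A * (u l - L) by rewrite mulr_ge0 ?(ltW A0)// subr_ge0.
rewrite uE in h1.
exfalso; lra.
Unshelve. all: by end_near. Qed.

(** Q(y_l) - P(y_l) is the increment of P between y_l and y_{l+1}. *)
Lemma orbit_gap u l : (forall l, 0 < u l < ystar) -> nonincreasing_seq u ->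
  (forall l, P (u l.+1) = Q (u l)) ->
  a * (u l - u l.+1) <= Q (u l) - P (u l) <= A * (u l - u l.+1).
Proof.
move=> uI ud uE; have /andP[u0 us] := uI l; have /andP[u10 _] := uI l.+1.
by rewrite -uE; apply: Plip => //; [exact: ltW|exact: ud].
Qed.

(** P and Q are both comparable to - y, since they vanish at 0. *)
Lemma orbit_ratio u l : (forall l, 0 < u l < ystar) ->
  (forall l, P (u l.+1) = Q (u l)) -> a / A * u l <= u l.+1.
Proof.
move=> uI uE; have /andP[u0 us] := uI l; have /andP[u10 u1s] := uI l.+1.
rewrite mulrAC ler_pdivrMr//.
have /andP[+ _] := Qlip (lexx 0) (ltW u0) us.
have /andP[_ +] := Plip (lexx 0) (ltW u10) u1s.
rewrite uE P0 Q0 !subr0 => h1 h2; rewrite mulrC; lra.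
Qed.

(** Any bounded set has zero upper content at exponents above 1; below 1 the
    lower content is positive because the gaps are O(u^N) with
    1/N <= 1 - s. *)
Lemma flat_orbit_dim :
  (forall N : nat, exists C eta, [/\ 0 < C, 0 < eta &
    forall y, 0 < y < ystar -> y < eta -> Q y - P y <= C * y ^+ N]) ->
  exists2 u, unique (is_orbit (slow_relation ystar P Q) y0) u &
    has_minkowski_dim (range u) 1.
Proof.
move=> flat; have [u [uu uI ud ucvg uE]] := orbit_exists; exists u => //.
have upos l : 0 < u l by case/andP: (uI l).
apply: has_minkowski_dim_of => // s.
  move=> s1; apply: (@upper_content_eq0 _ _ (u 0%N + 4) 0); last by rewrite subr0.
  near=> d.
  have d0 : 0 < d by near: d; exact: nbhs_right_gt.
  have d1 : d <= 1 by near: d; exact: nbhs_right_le.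
  apply: le_trans (closed_nbhd_measure_le upos 0 ud d0) _.
  by rewrite powRr0 mulr1 lee_fin lerD2l mulr1 ler_piMr.
move=> s0 s1.
pose N := (Num.truncn (1 - s)^-1).+1.
have s1' : 0 < 1 - s by rewrite subr_gt0.
have NP : (1 - s)^-1 < N%:R := truncnS_gt _.
have N0 : 0 < N%:R :> R by rewrite ltr0n.
have [C [eta [C0 eta0 H]]] := flat N.
have gap l : u l < eta -> u l - u l.+1 <= C / a * u l `^ N%:R.
  move=> ul; rewrite powR_mulrn ?(ltW (upos l))// mulrAC ler_pdivlMr// mulrC.
  by case/andP: (orbit_gap l uI ud uE) => /le_trans + _; apply; exact: H.
have [k k0 Hk] := powerlaw_gap_measure_ge upos ucvg (divr_gt0 a0 A0)
  (divr_gt0 C0 a0) N0 eta0 (fun l => orbit_ratio l uI uE) gap.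
apply: lt_le_trans (_ : 0 < k%:E)%E _ => //.
apply: (lower_content_ge Hk) => //.
have : N%:R^-1 <= 1 - s by rewrite -[leRHS]invrK lef_pV2 ?posrE ?invr_gt0// ltW.
lra.
Unshelve. all: by end_near. Qed.

(** The exponent al = (m+1)/2 equals 1 when m = 1, where
    [powerlaw_gap_measure_le] does not apply.  For s > d it is used with an
    exponent t >= al, t > 1, such that d < 1 - 1/t < s: the lower bound on the
    gaps persists because u is bounded.  The case t = al > 1 gives the finite
    upper content. *)
Lemma finite_order_orbit_dim m c1 c2 : (1 <= m)%N -> 0 < c1 -> 0 < c2 ->
  (forall y, 0 < y < ystar ->
    c1 * y `^ (m.+1%:R / 2) <= Q y - P y <= c2 * y `^ (m.+1%:R / 2)) ->
  exists2 u, unique (is_orbit (slow_relation ystar P Q) y0) u &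
    [/\ nonincreasing_seq u, u @ \oo --> 0,
        (exists d : R, has_minkowski_dim (range u) d /\
                         m%:R = (1 + d) / (1 - d)) &
          ((1 < m)%N -> minkowski_nondegenerate (range u))].
Proof.
move=> m1 c10 c20 HQP; have [u [uu uI ud ucvg uE]] := orbit_exists; exists u => //.
have upos l : 0 < u l by case/andP: (uI l).
pose al : R := m.+1%:R / 2.
have al1 : 1 <= al by rewrite ler_pdivlMr// mul1r ler_nat.
have al0 : 0 < al by exact: lt_le_trans al1.
pose c := c1 / A.
have c0 : 0 < c by exact: divr_gt0.
have lo l : c * u l `^ al <= u l - u l.+1.
  rewrite /c mulrAC ler_pdivrMr// mulrC.
  have /andP[_ gA] := orbit_gap l uI ud uE.
  rewrite mulrC [leRHS]mulrC; apply: le_trans gA.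
  by have /andP[] := HQP _ (uI l).
have hi l : u l < ystar -> u l - u l.+1 <= c2 / a * u l `^ al.
  move=> _; rewrite mulrAC ler_pdivlMr// mulrC.
  have /andP[+ _] := orbit_gap l uI ud uE; move/le_trans; apply.
  by have /andP[] := HQP _ (uI l).
have [k k0 Hk] := powerlaw_gap_measure_ge upos ucvg (divr_gt0 a0 A0)
  (divr_gt0 c20 a0) al0 ys0 (fun l => orbit_ratio l uI uE) hi.
pose d := 1 - al^-1.
have dE : m%:R = (1 + d) / (1 - d).
  rewrite /d /al -natr1; field.
  have -> : m%:R + 1 - (m%:R + 1 - 2) = 2 :> R by ring.
  by rewrite natr1 gt_eqF//= pnatr_eq0.
have d0 : 0 <= d by rewrite subr_ge0 invf_le1.
have kd s : s <= d -> (k%:E <= lower_content s (range u))%E.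
  by move=> sd; apply: (lower_content_ge Hk).
have upM t : al <= t -> 1 < t -> exists M, \forall e \near (0 : R)^'+,
    (lebesgue_measure (closed_nbhd (range u) e) <= (M * e `^ t^-1)%:E)%E.
  move=> alt t1.
  apply: (@powerlaw_gap_measure_le _ u upos (c / ystar `^ (t - al))) => //.
    by rewrite divr_gt0// powR_gt0.
  move=> l; apply: le_trans (lo l).
  rewrite -mulrA ler_pM2l// mulrC ler_pdivrMr ?powR_gt0//.
  have -> : t = al + (t - al) by ring.
  rewrite powRD_gt0// ler_wpM2l ?powR_ge0//.
  have -> : al + (t - al) - al = t - al by ring.
  apply: ge0_ler_powR; rewrite ?nnegrE ?subr_ge0 ?(ltW ys0) ?(ltW (upos l))//.
  by case/andP: (uI l) => _ /ltW.
split => //.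
- exists d; split => //; apply: has_minkowski_dim_of => // s.
    move=> ds.
    (* Halving towards s and towards 1 keeps t = 1 / (1 - s') finite. *)
    pose s' := Num.min ((d + s) / 2) ((d + 1) / 2).
    have d1 : d < 1 by rewrite /d gtrBl invr_gt0.
    have sl : d < s'.
      by rewrite lt_min; apply/andP; split; rewrite ltr_pdivlMr//; lra.
    have s's : s' < s by rewrite gt_min ltr_pdivrMr//; apply/orP; left; lra.
    have s'1 : s' < 1 by rewrite gt_min [X in _ || X]ltr_pdivrMr//; apply/orP; right; lra.
    pose t := (1 - s')^-1.
    have t0 : 0 < 1 - s' by rewrite subr_gt0.
    have alt : al <= t.
      rewrite -[al]invrK lef_pV2 ?posrE ?invr_gt0//; move: sl; rewrite /d; lra.
    have t1 : 1 < t by rewrite /t invf_gt1// ltrBlDr ltrDl (le_lt_trans d0).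
    have [M HM] := upM t alt t1.
    by apply: (upper_content_eq0 HM); rewrite /t invrK subKr.
  move=> _ sd; apply: lt_le_trans (kd s (ltW sd)); by rewrite lte_fin.
move=> m2.
have al2 : 1 < al by rewrite ltr_pdivlMr// mul1r ltr_nat.
have [M HM] := upM al (lexx _) al2.
exists d; split => //.
- apply: lt_le_trans (kd d (lexx _)); by rewrite lte_fin.
- exact: lower_content_le_upper.
- apply: le_lt_trans (upper_content_le HM) _; exact: ltry.
Qed.

End dynamics.

(** * Slow divergence integrals *)

Section integrals.
Context {R : realType}.
Implicit Types (D h : R -> R) (b B r s x y c : R) (n : nat).
Local Notation mu := (@lebesgue_measure R).

(** The estimate is written with s D(s) so that it holds on both sides of 0 and
    is invariant under the reflection D(s) -> - D(- s). *)
Definition negative_slope b B r D := forall s, `|s| < r ->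
  {for s, continuous D} /\ b * s ^+ 2 <= - (s * D s) <= B * s ^+ 2.

Lemma negative_slopeN b B r D :
  negative_slope b B r D -> negative_slope b B r (fun s => - D (- s)).
Proof.
move=> DD s sr; have := DD (- s); rewrite normrN => /(_ sr)[cD bD]; split.
  apply: cvgN; apply: (@continuous_comp _ _ _ -%R D) => //.
  exact: opp_continuous.
by move: bD; rewrite sqrrN mulrN opprK mulNr opprK.
Qed.

Lemma negative_slope_sub b B r b' B' r' D :
  negative_slope b B r D -> b' <= b -> B <= B' -> r' <= r ->
  negative_slope b' B' r' D.
Proof.
move=> DD bb BB rr s sr; have [|cD /andP[h1 h2]] := DD s; first exact: lt_le_trans rr.
split => //; apply/andP; split.
  by apply: le_trans h1; rewrite ler_wpM2r// sqr_ge0.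
by apply: (le_trans h2); rewrite ler_wpM2r// sqr_ge0.
Qed.

Lemma Cn_at0_negative_slope D : Cn_at0 1 D -> D 0 = 0 -> derive1 D 0 < 0 ->
  exists b B r, [/\ 0 < b, 0 < B, 0 < r & negative_slope b B r D].
Proof.
move=> nD D0 dD; pose k := - derive1 D 0; have k0 : 0 < k by rewrite oppr_gt0.
have k20 : 0 < k / 2 by lra.
have [|r1 r10 H1] := Cn_at0_peano_le nD k20; first by case.
have cD : \forall x \near (0 : R), {for x, continuous D}.
  have dDx := Cn_at0S_derive nD; near=> x.
  apply: differentiable_continuous; apply/derivable1_diffP.
  by apply: ex_derive; exact: (near dDx x).
have [r2 /= r20 H2] := cD.
exists (k / 2), (2 * k), (Num.min r1 r2); split => //.
- by rewrite mulr_gt0.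
- by rewrite lt_min r10.
move=> s; rewrite lt_min => /andP[sr1 sr2]; split.
  by apply: H2; rewrite /= sub0r normrN.
have [->|s0] := eqVneq s 0; first by rewrite expr0n !mulr0 mul0r oppr0 lexx.
have := H1 s; rewrite normr_gt0 s0 sr1 => /(_ isT).
rewrite /taylor_coef0 derive1n1 divr1 !expr1 -[derive1 D 0]opprK -/k mulNr opprK.
have ns : 0 < `|s| by rewrite normr_gt0.
move=> /(ler_wpM2l (ltW ns)); rewrite -normrM mulrDr.
have -> : `|s| * (k / 2 * `|s|) = k / 2 * s ^+ 2.
  by rewrite mulrCA -expr2 real_normK// num_real.
rewrite ler_norml => /andP[h1 h2]; rewrite expr2 in h1 h2 *.
have := sqr_ge0 s; rewrite expr2 => ss.
have kss : 0 <= k * (s * s) by rewrite mulr_ge0// ltW.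
apply/andP; split; lra.
Unshelve. all: by end_near. Qed.

Lemma negative_slope_bounds b B r D s :
  0 < b -> negative_slope b B r D -> 0 < s -> s < r ->
  - (B * s) <= D s <= - (b * s).
Proof.
move=> b0 DD s0 sr; have [|_] := DD s; first by rewrite gtr0_norm.
move=> /andP[h1 h2]; apply/andP; split.
  rewrite lerNl -(ler_pM2l s0); lra.
rewrite lerNr -(ler_pM2l s0); lra.
Qed.

(** At 0 the quotient is 0 / 0 = 0, which is its limit: it is bounded by
    |s| / b. *)
Lemma negative_slope_continuous b B r D s : 0 < b -> negative_slope b B r D -> `|s| < r ->
  {for s, continuous (fun x => x ^+ 2 / D x)}.
Proof.
move=> b0 DD sr; have [s0|s0] := eqVneq s 0; last first.
  have [cD /andP[bD _]] := DD _ sr.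
  apply: cvgM; first exact: exprn_continuous.
  apply: cvgV => //; apply/eqP => D0; move: bD; rewrite D0 mulr0 oppr0.
  by rewrite leNgt mulr_gt0// exprn_even_gt0.
rewrite s0 in sr *.
rewrite /prop_for /continuous_at expr0n mul0r.
apply/cvgrPdist_le => e e0; near=> t.
have tr : `|t| < r.
  near: t; rewrite normr0 in sr.
  have /cvgrPdist_lt/(_ r sr) := @cvg_id _ (nbhs (0 : R)).
  by apply: filterS => t; rewrite sub0r normrN.
have te : `|t| <= b * e.
  near: t.
  have /cvgrPdist_le/(_ (b * e)) := @cvg_id _ (nbhs (0 : R)).
  rewrite mulr_gt0// => /(_ isT).
  by apply: filterS => t; rewrite sub0r normrN.
rewrite sub0r normrN normrM normfV.
have [->|t0] := eqVneq t 0; first by rewrite expr0n normr0 mul0r ltW.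
have [_ /andP[bD _]] := DD _ tr.
have nt0 : 0 < `|t| by rewrite normr_gt0.
have Db : b * `|t| <= `|D t|.
  rewrite -(ler_pM2l nt0) -normrM mulrCA -expr2 -normrX (ger0_norm (sqr_ge0 t)).
  by rewrite -normrN; exact: le_trans bD (ler_norm _).
have D0 : 0 < `|D t| by apply: lt_le_trans Db; exact: mulr_gt0.
rewrite ler_pdivrMr// normrX expr2 (le_trans (ler_wpM2r (ltW nt0) te))//.
by rewrite mulrAC mulrC ler_pM2l.
Unshelve. all: by end_near. Qed.

Lemma negative_slope_within b B r D x y : 0 < b -> negative_slope b B r D ->
  - r < x -> y < r -> {within `[x, y], continuous (fun x => x ^+ 2 / D x)}.
Proof.
move=> b0 DD xr yr; apply: continuous_in_subspaceT => s.
rewrite inE/= in_itv/= => /andP[xs sy]; apply: (negative_slope_continuous b0 DD).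
by rewrite ltr_norml (lt_le_trans xr)// (le_lt_trans sy).
Qed.

Lemma sqrt_lt r y : 0 < r -> y < r ^+ 2 -> Num.sqrt y < r.
Proof.
move=> r0 yr.
by rewrite -[ltRHS](ger0_norm (ltW r0)) -sqrtr_sqr ltr_sqrt// exprn_gt0.
Qed.

Definition slow_integral D y := 4 * \int[mu]_(s in `[0, Num.sqrt y]) (s ^+ 2 / D s).

Lemma slow_integral0 D : slow_integral D 0 = 0.
Proof. by rewrite /slow_integral sqrtr0 set_itv1 Rintegral_set1 mulr0. Qed.

Lemma IplusE (G psi : R -> R) y : 0 <= y ->
  Iplus G psi y = slow_integral (slow_drift G psi) y.
Proof.
move=> y0; rewrite /Iplus /slow_div_integral /oriented_integral /slow_integral.
case: ifP => [sy|_]; last by rewrite mulrN mulNr opprK.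
have -> : Num.sqrt y = 0 by apply/eqP; rewrite eq_le sy sqrtr_ge0.
by rewrite set_itv1 !Rintegral_set1 !mulr0.
Qed.

(** The reflection x = - s maps [- sqrt y, 0] to [0, sqrt y]. *)
Lemma IminusE b B r (G psi : R -> R) y :
  0 < b -> negative_slope b B r (slow_drift G psi) ->
  0 <= y -> Num.sqrt y < r ->
  Iminus G psi y = slow_integral (fun s => - slow_drift G psi (- s)) y.
Proof.
move=> b0 DD y0 yr.
rewrite /Iminus /slow_div_integral /oriented_integral /slow_integral.
rewrite oppr_le0 sqrtr_ge0 mulNr -mulrN; congr (_ * _).
have -> : \int[mu]_(x in `[(- Num.sqrt y), 0]) (x ^+ 2 / slow_drift G psi x) =
  \int[mu]_(x in `[0, Num.sqrt y]) (- (x ^+ 2 / - slow_drift G psi (- x))).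
  rewrite /Rintegral -[X in `[_, X]]oppr0.
  rewrite (integration_by_substitution_oppr (sqrtr_ge0 y)).
    congr fine; apply: eq_integral => x _; congr EFin.
    by rewrite /= sqrrN invrN mulrN opprK.
  apply: (negative_slope_within b0 DD); rewrite ?ltrN2// oppr0.
  exact: le_lt_trans yr.
set h := fun s => s ^+ 2 / - slow_drift G psi (- s).
rewrite [RHS](_ : _ = - (- 1 * \int[mu]_(s in `[0, Num.sqrt y]) h s)); last first.
  by rewrite mulN1r opprK.
rewrite -RintegralZl//; last first.
  apply: continuous_compact_integrable; first exact: segment_compact.
  apply: (negative_slope_within b0 (negative_slopeN DD)) => //.
  by rewrite oppr_lt0 (le_lt_trans _ yr).
by congr (- _); apply: eq_Rintegral => x _; rewrite mulN1r.
Qed.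

Lemma Rintegral_exprn n y : 0 <= y ->
  \int[mu]_(s in `[0, y]) (s ^+ n) = y ^+ n.+1 / n.+1%:R.
Proof.
rewrite le_eqVlt => /predU1P[<-|y0].
  by rewrite set_itv1 Rintegral_set1 expr0n mul0r.
have dF s : is_derive s (1 : R) (fun s => s ^+ n.+1 / n.+1%:R) (s ^+ n).
  have := @is_deriveM _ _ _ (cst n.+1%:R^-1) s 1 _ _ (is_derive_exprn s n)
    (is_derive_cst _ _ _).
  by rewrite /GRing.scale/= mulr0 add0r mulKf// pnatr_eq0.
have cF s : {for s, continuous (fun s : R => s ^+ n.+1 / n.+1%:R)}.
  by apply: cvgM; [exact: exprn_continuous|exact: cvg_cst].
rewrite /Rintegral (@continuous_FTC2 R (fun s => s ^+ n)
  (fun s => s ^+ n.+1 / n.+1%:R))//.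
- by rewrite -EFinB/= expr0n mul0r subr0.
- by apply: continuous_in_subspaceT => s _; exact: exprn_continuous.
- split => [s _||].
  + by case: (dF s).
  + by apply: cvg_at_right_filter; exact: cF.
  + by apply: cvg_at_left_filter; exact: cF.
- by move=> s _; rewrite derive1E; have [_] := dF s.
Qed.

Lemma within_integrable h x y : {within `[x, y], continuous h} ->
  mu.-integrable `[x, y] (EFin \o h).
Proof. by apply: continuous_compact_integrable; exact: segment_compact. Qed.

Lemma le_Rintegral_diff h1 h2 x y : 0 <= x -> x <= y ->
  {within `[0, y], continuous h1} -> {within `[0, y], continuous h2} ->
  (forall s, 0 < s -> s <= y -> h1 s <= h2 s) ->
  \int[mu]_(s in `[0, y]) h1 s - \int[mu]_(s in `[0, x]) h1 s <=
  \int[mu]_(s in `[0, y]) h2 s - \int[mu]_(s in `[0, x]) h2 s.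
Proof.
move=> x0 xy c1 c2 h12.
have i1 := within_integrable c1; have i2 := within_integrable c2.
rewrite !Rintegral_itvB ?bnd_simp//.
have sub : `]x, y] `<=` `[0, y].
  move=> s /=; rewrite !in_itv/= => /andP[xs ->]; rewrite andbT.
  exact: le_trans (ltW xs).
apply: le_Rintegral => //.
- exact: integrableS i1.
- exact: integrableS i2.
- move=> s /=; rewrite in_itv/= => /andP[xs sy]; apply: h12 => //.
  exact: le_lt_trans xs.
Qed.

Lemma Rintegral_power_bounds h c1 c2 n x y : 0 <= x -> x <= y ->
  {within `[0, y], continuous h} ->
  (forall s, 0 < s -> s <= y -> c1 * s ^+ n <= h s <= c2 * s ^+ n) ->
  c1 * ((y ^+ n.+1 - x ^+ n.+1) / n.+1%:R) <=
  \int[mu]_(s in `[0, y]) h s - \int[mu]_(s in `[0, x]) h s <=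
  c2 * ((y ^+ n.+1 - x ^+ n.+1) / n.+1%:R).
Proof.
move=> x0 xy ch hb; have y0 := le_trans x0 xy.
have cX c z : {within `[0, z], continuous (fun s : R => c * s ^+ n)}.
  apply: continuous_in_subspaceT => s _.
  by apply: cvgM; [exact: cvg_cst|exact: exprn_continuous].
have cXn z : {within `[0, z], continuous (fun s : R => s ^+ n)}.
  by apply: continuous_in_subspaceT => s _; exact: exprn_continuous.
have E c : c * ((y ^+ n.+1 - x ^+ n.+1) / n.+1%:R) =
    \int[mu]_(s in `[0, y]) (c * s ^+ n) - \int[mu]_(s in `[0, x]) (c * s ^+ n).
  rewrite !RintegralZl ?Rintegral_exprn//; try exact: within_integrable.
  by rewrite -mulrBr -mulrBl.
rewrite !E; apply/andP; split; apply: le_Rintegral_diff => // s s0 sy.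
  by case/andP: (hb s s0 sy).
by case/andP: (hb s s0 sy).
Qed.

(** The integrand lies between - s / b and - s / B, and the integral of s over
    [sqrt z, sqrt y] is (y - z) / 2. *)
Lemma slow_integral_bilipschitz b B r D : 0 < b -> 0 < B -> 0 < r ->
  negative_slope b B r D ->
  decreasing_bilipschitz (2 / B) (2 / b) (r ^+ 2) (slow_integral D).
Proof.
move=> b0 B0 r0 DD z y z0 zy yr.
have sy : Num.sqrt y < r by exact: sqrt_lt.
have szy : Num.sqrt z <= Num.sqrt y by exact: ler_wsqrtr.
have y0 := le_trans z0 zy.
have := @Rintegral_power_bounds (fun s => s ^+ 2 / D s) (- b^-1) (- B^-1) 1 _ _
  (sqrtr_ge0 z) szy.
rewrite !sqr_sqrtr// => /(_ _ _)/andP[||h1 h2].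
- by apply: (negative_slope_within b0 DD) => //; rewrite oppr_lt0.
- move=> s s0 ssy; rewrite expr1.
  have /andP[Ds1 Ds2] := negative_slope_bounds b0 DD s0 (le_lt_trans ssy sy).
  have bs0 : 0 < b * s by exact: mulr_gt0.
  have D0 : 0 < - D s by rewrite oppr_gt0; lra.
  have -> : s ^+ 2 / D s = - (s ^+ 2 / - D s) by rewrite invrN mulrN opprK.
  rewrite !mulNr !lerN2; apply/andP; split.
    rewrite ler_pdivrMr// -mulrA -ler_pdivrMl ?invr_gt0// invrK expr2.
    rewrite mulrA -[b * s * s]mulrC ler_pM2l//; lra.
  rewrite ler_pdivlMr// -mulrA ler_pdivrMl// expr2 mulrCA ler_pM2l//; lra.
rewrite /slow_integral; lra.
Qed.

End integrals.

(** * Comparison of the two integrals and the orbits *)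

Section slow_flow.
Context {R : realType}.
Implicit Types (D f : R -> R) (b B r s x y c e : R) (n m N : nat).

Lemma slow_bilipschitz b B r D ystar f :
  0 < b -> 0 < B -> 0 < r -> negative_slope b B r D -> ystar <= r ^+ 2 ->
  (forall y, 0 <= y -> y < ystar -> f y = slow_integral D y) ->
  decreasing_bilipschitz (2 / B) (2 / b) ystar f.
Proof.
move=> b0 B0 r0 dD ysr fE z y z0 zy ys.
rewrite !fE//; [|exact: le_trans zy|exact: le_lt_trans ys].
by apply: (slow_integral_bilipschitz b0 B0 r0 dD) => //; exact: lt_le_trans ysr.
Qed.

Section comparison.
Variables (b B r : R) (D1 D2 : R -> R).
Hypotheses (b0 : 0 < b) (B0 : 0 < B) (r0 : 0 < r).
Hypotheses (d1 : negative_slope b B r D1) (d2 : negative_slope b B r D2).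

(** s^2 / (D1 D2) is the weight against which D2 - D1 is integrated in the
    difference of the two slow integrals. *)
Let weight s : 0 < s -> s < r ->
  0 <= s ^+ 2 / (D1 s * D2 s) /\
  (B ^+ 2)^-1 <= s ^+ 2 / (D1 s * D2 s) <= (b ^+ 2)^-1.
Proof.
move=> s0 sr; have /andP[h1 h2] := negative_slope_bounds b0 d1 s0 sr.
have /andP[h3 h4] := negative_slope_bounds b0 d2 s0 sr.
have bs : 0 < b * s by rewrite mulr_gt0.
have dd : 0 < D1 s * D2 s by rewrite -(mulrNN (D1 s)) mulr_gt0//; lra.
split; first by rewrite divr_ge0 ?sqr_ge0 ?(ltW dd).
apply/andP; split.
  rewrite ler_pdivlMr// ler_pdivrMl ?exprn_gt0// -exprMn.
  by rewrite -(mulrNN (D1 s)) expr2; apply: ler_pM; lra.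
rewrite ler_pdivrMr// ler_pdivlMl ?exprn_gt0// -exprMn.
by rewrite -(mulrNN (D1 s)) expr2; apply: ler_pM; lra.
Qed.

Let fracE s : 0 < s -> s < r ->
  s ^+ 2 / D1 s - s ^+ 2 / D2 s = (D2 s - D1 s) * (s ^+ 2 / (D1 s * D2 s)).
Proof.
move=> s0 sr; have /andP[h1 h2] := negative_slope_bounds b0 d1 s0 sr.
have /andP[h3 h4] := negative_slope_bounds b0 d2 s0 sr.
have bs : 0 < b * s by rewrite mulr_gt0.
field; apply/andP; split; rewrite lt_eqF//; lra.
Qed.

Let wi D y : negative_slope b B r D -> y < r ^+ 2 ->
  {within `[0, Num.sqrt y], continuous (fun s => s ^+ 2 / D s)}.
Proof.
by move=> dD yr; apply: (negative_slope_within b0 dD); rewrite ?oppr_lt0 ?sqrt_lt.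
Qed.

Let slow_integralB y : y < r ^+ 2 ->
  slow_integral D1 y - slow_integral D2 y =
  4 * \int[lebesgue_measure]_(s in `[0, Num.sqrt y]) (s ^+ 2 / D1 s - s ^+ 2 / D2 s).
Proof.
move=> yr; rewrite /slow_integral RintegralB//; last 2 first.
- exact: within_integrable (wi d1 yr).
- exact: within_integrable (wi d2 yr).
by rewrite mulrBr.
Qed.

Let wiB y : y < r ^+ 2 ->
  {within `[0, Num.sqrt y], continuous (fun s => s ^+ 2 / D1 s - s ^+ 2 / D2 s)}.
Proof. by move=> yr x; apply: cvgB; [exact: (wi d1 yr)|exact: (wi d2 yr)]. Qed.

Let wiX c n z : {within `[0, z], continuous (fun s : R => c * s ^+ n)}.
Proof.
apply: continuous_in_subspaceT => s _.
by apply: cvgM; [exact: cvg_cst|exact: exprn_continuous].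
Qed.

Let intX c n y : 0 <= y ->
  4 * \int[lebesgue_measure]_(s in `[0, Num.sqrt y]) (c * s ^+ n) =
  4 * c / n.+1%:R * Num.sqrt y ^+ n.+1.
Proof.
move=> y0; rewrite RintegralZl//; last first.
  apply: within_integrable; apply: continuous_in_subspaceT => s _.
  exact: exprn_continuous.
by rewrite Rintegral_exprn ?sqrtr_ge0//; ring.
Qed.

Lemma slow_integral_diff_le n c y : 0 <= c -> 0 <= y -> y < r ^+ 2 ->
  (forall s, 0 < s -> s < r -> D2 s - D1 s <= c * s ^+ n) ->
  slow_integral D1 y - slow_integral D2 y <=
  4 * (c / b ^+ 2) / n.+1%:R * Num.sqrt y ^+ n.+1.
Proof.
move=> c0 y0 yr H; rewrite slow_integralB// -intX// ler_pM2l//.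
have := @le_Rintegral_diff _ _ _ 0 (Num.sqrt y) (lexx _) (sqrtr_ge0 y) (wiB yr)
  (@wiX (c / b ^+ 2) n (Num.sqrt y)).
rewrite set_itv1 !Rintegral_set1 !subr0; apply => s s0 sy.
have sr := le_lt_trans sy (sqrt_lt r0 yr).
have [w0 /andP[_ wb]] := weight s0 sr.
rewrite fracE//; apply: le_trans (ler_wpM2r w0 (H s s0 sr)) _.
by rewrite [leRHS]mulrAC ler_wpM2l// mulr_ge0// exprn_ge0// ltW.
Qed.

Lemma slow_integral_diff_ge n c y : 0 <= c -> 0 <= y -> y < r ^+ 2 ->
  (forall s, 0 < s -> s < r -> c * s ^+ n <= D2 s - D1 s) ->
  4 * (c / B ^+ 2) / n.+1%:R * Num.sqrt y ^+ n.+1 <=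
  slow_integral D1 y - slow_integral D2 y.
Proof.
move=> c0 y0 yr H; rewrite slow_integralB// -intX// ler_pM2l//.
have := @le_Rintegral_diff _ _ _ 0 (Num.sqrt y) (lexx _) (sqrtr_ge0 y)
  (@wiX (c / B ^+ 2) n (Num.sqrt y)) (wiB yr).
rewrite set_itv1 !Rintegral_set1 !subr0; apply => s s0 sy.
have sr := le_lt_trans sy (sqrt_lt r0 yr).
have [w0 /andP[Bw _]] := weight s0 sr.
rewrite fracE//; apply: le_trans (ler_wpM2r w0 (H s s0 sr)).
by rewrite [leLHS]mulrAC ler_wpM2l// mulr_ge0// exprn_ge0// ltW.
Qed.

Variables (P Q : R -> R) (ystar y0 : R).
Hypotheses (ystar_r : ystar <= r ^+ 2) (y0P : 0 < y0 < ystar).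
Hypothesis PE : forall y, 0 <= y -> y < ystar -> P y = slow_integral D2 y.
Hypothesis QE : forall y, 0 <= y -> y < ystar -> Q y = slow_integral D1 y.

Let ystar_gt0 : 0 < ystar. Proof. by case/andP: y0P => /lt_trans; exact. Qed.
Let a0 : 0 < 2 / B. Proof. exact: divr_gt0. Qed.
Let P0 : P 0 = 0. Proof. by rewrite PE// slow_integral0. Qed.
Let Q0 : Q 0 = 0. Proof. by rewrite QE// slow_integral0. Qed.

Let Plip := slow_bilipschitz b0 B0 r0 d2 ystar_r PE.
Let Qlip := slow_bilipschitz b0 B0 r0 d1 ystar_r QE.

Lemma slow_orbit_finite_order m c : (1 <= m)%N -> 0 < c ->
  (forall s, 0 < s -> s < r -> `|D2 s - D1 s - c * s ^+ m| <= c / 2 * s ^+ m) ->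
  exists2 u, unique (is_orbit (slow_relation ystar P Q) y0) u &
    [/\ nonincreasing_seq u, u @ \oo --> 0,
        (exists d : R, has_minkowski_dim (range u) d /\
                         m%:R = (1 + d) / (1 - d)) &
          ((1 < m)%N -> minkowski_nondegenerate (range u))].
Proof.
move=> m1 c0 H.
have bd s : 0 < s -> s < r -> c / 2 * s ^+ m <= D2 s - D1 s <= 2 * c * s ^+ m.
  move=> s0 sr; have := H s s0 sr; rewrite ler_norml => /andP[h1 h2].
  have h3 : 0 < c * s ^+ m by rewrite mulr_gt0// exprn_gt0.
  by apply/andP; split; lra.
have kpos (k : R) n : 0 < k -> 0 < 4 * k / n.+1%:R.
  by move=> k0; rewrite divr_gt0// mulr_gt0.
have k1 : 0 < 4 * (c / 2 / B ^+ 2) / m.+1%:R.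
  by apply: kpos; rewrite !divr_gt0// exprn_gt0.
have k2 : 0 < 4 * (2 * c / b ^+ 2) / m.+1%:R.
  by apply: kpos; rewrite divr_gt0 ?mulr_gt0// exprn_gt0.
have est y : 0 < y < ystar ->
    4 * (c / 2 / B ^+ 2) / m.+1%:R * y `^ (m.+1%:R / 2) <= Q y - P y <=
    4 * (2 * c / b ^+ 2) / m.+1%:R * y `^ (m.+1%:R / 2).
  move=> /andP[yg0 ys]; have yr := lt_le_trans ys ystar_r.
  rewrite PE ?QE ?(ltW yg0)//.
  have -> : y `^ (m.+1%:R / 2) = Num.sqrt y ^+ m.+1.
    by rewrite mulrC powRrM powR12_sqrt ?(ltW yg0)// powR_mulrn// sqrtr_ge0.
  apply/andP; split.
    apply: slow_integral_diff_ge; rewrite ?(ltW yg0)//; first lra.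
    by move=> s s0 sr; case/andP: (bd s s0 sr).
  apply: slow_integral_diff_le; rewrite ?(ltW yg0)//; first lra.
  by move=> s s0 sr; case/andP: (bd s s0 sr).
apply: (finite_order_orbit_dim a0 Plip Qlip P0 Q0 _ y0P m1 k1 k2 est).
move=> y ys; have /andP[h _] := est y ys; rewrite -subr_gt0.
by apply: lt_le_trans h; rewrite mulr_gt0// powR_gt0//; case/andP: ys.
Qed.

End comparison.

(** Flatness at order 2 N of D2 - D1 gives a bound by sqrt(y)^(2N+1), hence by a
    multiple of y^N. *)
Lemma slow_orbit_flat b B r D1 D2 (P Q : R -> R) (ystar y0 : R) :
  0 < b -> 0 < B -> 0 < r -> negative_slope b B r D1 -> negative_slope b B r D2 ->
  ystar <= r ^+ 2 -> 0 < y0 < ystar ->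
  (forall y, 0 <= y -> y < ystar -> P y = slow_integral D2 y) ->
  (forall y, 0 <= y -> y < ystar -> Q y = slow_integral D1 y) ->
  (forall N, exists2 q, 0 < q &
    forall s, 0 < s -> s < q -> `|D2 s - D1 s| <= s ^+ N) ->
  (forall y, 0 < y < ystar -> P y < Q y) ->
  exists2 u, unique (is_orbit (slow_relation ystar P Q) y0) u &
    has_minkowski_dim (range u) 1.
Proof.
move=> b0 B0 r0 d1 d2 ystar_r y0P PE QE flat PQ.
have ystar0 : 0 < ystar by case/andP: y0P => /lt_trans; exact.
have P0 : P 0 = 0 by rewrite PE// slow_integral0.
have Q0 : Q 0 = 0 by rewrite QE// slow_integral0.
have Plip := slow_bilipschitz b0 B0 r0 d2 ystar_r PE.
have Qlip := slow_bilipschitz b0 B0 r0 d1 ystar_r QE.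
have a0 : 0 < 2 / B by exact: divr_gt0.
apply: (flat_orbit_dim a0 Plip Qlip P0 Q0 PQ y0P) => N.
(* The pointwise bound holds on ]0, q[ only, so the comparison is made below the
   smaller radius p. *)
have [q q0 Hq] := flat N.*2.
pose p := Num.min r q.
have p0 : 0 < p by rewrite lt_min r0.
have pr : p <= r by rewrite ge_min lexx.
have dp1 := negative_slope_sub d1 (lexx b) (lexx B) pr.
have dp2 := negative_slope_sub d2 (lexx b) (lexx B) pr.
have k0 : 0 < 4 * (1 / b ^+ 2) / (N.*2).+1%:R.
  by rewrite divr_gt0// mulr_gt0// divr_gt0// exprn_gt0.
exists (4 * (1 / b ^+ 2) / (N.*2).+1%:R * p), (p ^+ 2); split.
- exact: mulr_gt0.
- exact: exprn_gt0.
move=> y /andP[yg0 ys] yp; rewrite QE ?PE ?(ltW yg0)//.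
have syp := ltW (sqrt_lt p0 yp).
apply: (@le_trans _ _ (4 * (1 / b ^+ 2) / (N.*2).+1%:R * Num.sqrt y ^+ (N.*2).+1)).
  apply: (slow_integral_diff_le b0 B0 p0 dp1 dp2) => //; first exact: ltW.
  move=> s s0 sp; rewrite mul1r (le_trans (ler_norm _))// Hq//.
  by rewrite (lt_le_trans sp)// ge_min lexx orbT.
rewrite -[leRHS]mulrA ler_wpM2l ?(ltW k0)//.
by rewrite exprS -mul2n exprM sqr_sqrtr ?(ltW yg0)// ler_wpM2r// exprn_ge0// ltW.
Qed.

Lemma zero_multiplicity_inj (f : R -> R) m n :
  zero_multiplicity f m -> zero_multiplicity f n -> m = n.
Proof.
move=> [m1 m2] [n1 n2]; case: (ltngtP m n) => // h.
  by move: m2; rewrite n1// eqxx.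
by move: n2; rewrite m1// eqxx.
Qed.

Lemma taylor_coef0_eq0 (f : R -> R) k : taylor_coef0 f k = 0 -> derive1n k f 0 = 0.
Proof.
move/eqP; rewrite mulf_eq0 invr_eq0 pnatr_eq0 -leqn0 leqNgt fact_gt0 orbF.
by move/eqP.
Qed.

End slow_flow.

Theorem theorem3p2 (R : realType) (fm fp Gm Gp psim psip : R -> R)
  (Fm_smooth : smooth_near0 (fun x => x ^+ 2 * fm x))
  (Fp_smooth : smooth_near0 (fun x => x ^+ 2 * fp x))
  (fm_cont : {for 0, continuous fm}) (fp_cont : {for 0, continuous fp})
  (fm0 : 0 < fm 0) (fp0 : 0 < fp 0)
  (Gm_smooth : smooth_near0 Gm) (Gp_smooth : smooth_near0 Gp)
  (Gm0 : Gm 0 = 0) (Gp0 : Gp 0 = 0)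
  (dGm0 : derive1 Gm 0 < 0) (dGp0 : derive1 Gp 0 < 0)
  (psim_inv : local_inverse0 (fun x => x * Num.sqrt (fm x)) psim)
  (psip_inv : local_inverse0 (fun x => x * Num.sqrt (fp x)) psip) :
  let Im := Iminus Gm psim in
  let Ip := Iplus Gp psip in
  let I := fun y => Ip y - Im y in
  let Gbar := fun x => slow_drift Gm psim x + slow_drift Gp psip (- x) in
  exists2 ybar : R, 0 < ybar &
  forall ystar : R, 0 < ystar <= ybar ->
  (forall y, 0 < y < ystar -> I y != 0) ->
  forall y0 : R, 0 < y0 < ystar ->
  let H := slow_relation ystar Im Ip in
  let Hinv := slow_relation ystar Ip Im in
  (forall m : nat, (1 <= m)%N -> zero_multiplicity Gbar m ->
    let c := (-1) ^+ m.+1 * taylor_coef0 Gbar m in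
    let conclusion := fun u : nat -> R =>
      [/\ nonincreasing_seq u, u @ \oo --> 0,
          (exists d : R, has_minkowski_dim (range u) d /\
                         m%:R = (1 + d) / (1 - d)) &
          ((1 < m)%N -> minkowski_nondegenerate (range u))] in
    (0 < c -> exists2 u, unique (is_orbit H y0) u & conclusion u) /\
    (c < 0 -> exists2 u, unique (is_orbit Hinv y0) u & conclusion u)) /\
  (zero_multiplicity_infinite Gbar ->
    ((forall y, 0 < y < ystar -> 0 < I y) ->
       exists2 u, unique (is_orbit H y0) u & has_minkowski_dim (range u) 1) /\
    ((forall y, 0 < y < ystar -> I y < 0) ->
       exists2 u, unique (is_orbit Hinv y0) u &
                  has_minkowski_dim (range u) 1)).
Proof.
move=> Im Ip I Gbar.
have [nDp Dp0 dDp] := slow_drift_at0 Fp_smooth fp_cont fp0 Gp_smooth Gp0 dGp0 psip_inv.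
have [nDm Dm0 dDm] := slow_drift_at0 Fm_smooth fm_cont fm0 Gm_smooth Gm0 dGm0 psim_inv.
have [bp [Bp [rp [bp0 Bp0 rp0 dwp]]]] := Cn_at0_negative_slope (nDp 1%N) Dp0 dDp.
have [bm [Bm [rm [bm0 Bm0 rm0 dwm]]]] := Cn_at0_negative_slope (nDm 1%N) Dm0 dDm.
pose D1 := slow_drift Gp psip; pose D2 s := - slow_drift Gm psim (- s).
(* At the reflected point, Gbar is the difference of the two drifts. *)
have GbarE s : Gbar (- s) = D1 s - D2 s.
  by rewrite /Gbar /D2 opprK opprK addrC.
have nGbar n : Cn_at0 n Gbar.
  apply: (@Cn_at0D _ (slow_drift Gm psim) (D1 \o -%R)) => //.
  apply: Cn_at0_comp => //; first exact: oppr0.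
  case: n => [|n]; first exact: opp_continuous.
  apply: (@Cn_at0S _ _ (cst (-1))); last exact: Cn_at0_cst.
  by near=> x; exact: is_deriveNid.
pose c m := (-1) ^+ m.+1 * taylor_coef0 Gbar m.
have GbarP m e : (forall k, (k < m)%N -> taylor_coef0 Gbar k = 0) -> 0 < e ->
    exists2 r, 0 < r & forall s, 0 < s -> s < r ->
    `|(D2 s - D1 s) - c m * s ^+ m| <= e * s ^+ m.
  move=> Hm e0; have [k km|r r0 H] := Cn_at0_peano_le (nGbar m) e0.
    exact/taylor_coef0_eq0/Hm.
  exists r => // s s0 sr; have := H (- s); rewrite normrN gtr0_norm// s0 sr => /(_ isT).
  rewrite GbarE exprNn /c exprS -normrN; apply: le_trans.
  by rewrite le_eqVlt; apply/orP; left; apply/eqP; congr (`|_|); ring.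
(* The radius must be fixed before m is given: it is chosen for the unique m
   with zero_multiplicity Gbar m if there is one, and arbitrarily otherwise. *)
have [r1 r10 Hr1] : exists2 r1, 0 < r1 & forall m, zero_multiplicity Gbar m ->
    forall s, 0 < s -> s < r1 ->
    `|(D2 s - D1 s) - c m * s ^+ m| <= `|c m| / 2 * s ^+ m.
  have [[m zm]|no] := pselect (exists m, zero_multiplicity Gbar m); last first.
    by exists 1 => // m zm; exfalso; apply: no; exists m.
  have cm0 : 0 < `|c m| / 2.
    by rewrite divr_gt0// normr_gt0 mulf_neq0 ?signr_eq0//; case: zm.
  have [r r0 H] := GbarP m _ zm.1 cm0.
  by exists r => // m' zm'; rewrite -(zero_multiplicity_inj zm zm').
pose b := Num.min bp bm; pose B := Num.max Bp Bm.
pose r := Num.min (Num.min rp rm) r1.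
have b0 : 0 < b by rewrite lt_min bp0.
have B0 : 0 < B by rewrite lt_max Bp0.
have r0 : 0 < r by rewrite !lt_min rp0 rm0.
have dw1 : negative_slope b B r D1.
  by apply: (negative_slope_sub dwp); rewrite ?ge_min ?le_max ?lexx ?orbT.
have dwm' : negative_slope b B r (slow_drift Gm psim).
  by apply: (negative_slope_sub dwm); rewrite ?ge_min ?le_max ?lexx ?orbT.
have dw2 : negative_slope b B r D2 := negative_slopeN dwm'.
have rr1 : r <= r1 by rewrite ge_min lexx orbT.
exists (r ^+ 2); first exact: exprn_gt0.
move=> ystar /andP[ystar0 ystarr] In0 y0 y0P H Hinv.
have IpE y : 0 <= y -> y < ystar -> Ip y = slow_integral D1 y.
  by move=> yge0 _; exact: IplusE.
have ImE y : 0 <= y -> y < ystar -> Im y = slow_integral D2 y.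
  move=> yge0 ys; apply: (IminusE b0 dwm') => //.
  by apply: sqrt_lt => //; exact: lt_le_trans ystarr.
split.
  move=> m m1 zm cm concl; have cE : c m = cm by [].
  have bnd s : 0 < s -> s < r ->
      `|D2 s - D1 s - cm * s ^+ m| <= `|cm| / 2 * s ^+ m.
    by move=> s0 sr; rewrite -cE; apply: Hr1 => //; exact: lt_le_trans rr1.
  split => [cm0|cm0].
    apply: (slow_orbit_finite_order b0 B0 r0 dw1 dw2 ystarr y0P ImE IpE m1 cm0).
    by rewrite -{2}(gtr0_norm cm0).
  have ncm0 : 0 < - cm by rewrite oppr_gt0.
  apply: (slow_orbit_finite_order b0 B0 r0 dw2 dw1 ystarr y0P IpE ImE m1 ncm0).
  move=> s s0 sr; rewrite -(ltr0_norm cm0); apply: le_trans (bnd s s0 sr).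
  by rewrite -normrN ltr0_norm// le_eqVlt; apply/orP; left; apply/eqP; congr (`|_|); ring.
move=> zinf.
have flat N : exists2 q, 0 < q &
    forall s, 0 < s -> s < q -> `|D2 s - D1 s| <= s ^+ N.
  have [//|q q0 Hq] := GbarP N 1 _ ltr01; exists q => // s s0 sq.
  by have := Hq s s0 sq; rewrite /c zinf mulr0 mul0r subr0 mul1r.
split => sgn.
  apply: (slow_orbit_flat b0 B0 r0 dw1 dw2 ystarr y0P ImE IpE flat) => y ys.
  by rewrite -subr_gt0; exact: sgn.
apply: (slow_orbit_flat b0 B0 r0 dw2 dw1 ystarr y0P IpE ImE) => [N|y ys].
  have [q q0 Hq] := flat N; exists q => // s s0 sq; rewrite distrC; exact: Hq.
by rewrite -subr_lt0; exact: sgn.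
Unshelve. all: by end_near. Qed.
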